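(* Let $\Gamma=\{a,b,c,d\}$, $L^{\mathrm{wrap}}=\{c^nwd^n:n\ge0,\ w\in\{a,b\}^+\}$, and let $h^{\mathrm{wrap}}:\Gamma^*\to M_{36}\times E$ be the finite-monoid morphism defined in the context. Then $L^{\mathrm{wrap}}$ is a nonregular context-free language, $(L^{\mathrm{wrap}},h^{\mathrm{wrap}})$ is unit-separated, $L^{\mathrm{wrap}}$ is $h^{\mathrm{wrap}}$-substitutable, the relative quotient $\Gamma^*/\theta_{L^{\mathrm{wrap}},h^{\mathrm{wrap}}}$ is infinite, and the set of relative primes is finite. Every live non-unit relative class has a unique exact factorization into relative primes, and $(L^{\mathrm{wrap}},h^{\mathrm{wrap}})$ satisfies FSRP but not FRP. More precisely, with $C,D,\mathsf M_p,W_s,\mathsf I_s$ as in the context: $$\mathrm{Val}_C=\mathrm{Val}_D=\varnothing;$$ for each $p\in\mathsf P_{36}$, the valid-return language $\mathrm{Val}_{\mathsf M_p}$ for $(L^{\mathrm{wrap}},h^{\mathrm{wrap}})$ is equal to the valid-return language $\mathrm{Val}_{\mathsf M_p}$ for the pair $(\{a,b\}^+,h_{36})$ over the alphabet $\{a,b\}$; and for every $s\in M_{36}\setminus\{1\}$, $$\mathrm{Val}_{W_s}=\{C\,W_s\,D\}\ \cup\ C\,\mathsf I_s\,D .$$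
   Context: The monoid $M_{36}$. Let $Q_0=\{0,1,2,3\}$. A transformation $f:Q_0\to Q_0$ is written as the tuple $(f(0),f(1),f(2),f(3))$, and products are composed from left to right: $(fg)(x)=g(f(x))$. Put $\tau_a=(1,2,0,0)$, $\tau_b=(1,3,1,0)$, and let $M_0$ be the submonoid (containing the identity) of the full transformation monoid on $Q_0$ generated by $\tau_a,\tau_b$. Let $h_0:\{a,b\}^*\to M_0$ be the morphism with $h_0(a)=\tau_a$, $h_0(b)=\tau_b$. Let $\sim_0$ be the least monoid congruence on $M_0$ with $h_0(ab)\sim_0 h_0(abaaab)$, let $M_{36}=M_0/{\sim_0}$ with projection $\pi_0$, and $h_{36}=\pi_0\circ h_0:\{a,b\}^*\to M_{36}$. The observer $h^{\mathrm{wrap}}$. Extend $h_{36}$ to $\widehat h_{36}:\Gamma^*\to M_{36}$ by $\widehat h_{36}(c)=\widehat h_{36}(d)=1$. Let $E=\{0,1\}^2$ with coordinatewise maximum as multiplication, and let $\chi(w)\in E$ record in its first coordinate whether $c$ occurs in $w$ and in its second whether $d$ occurs in $w$. Put $h^{\mathrm{wrap}}(w)=(\widehat h_{36}(w),\chi(w))$. General definitions, for a language $L$ over a finite alphabet $\Sigma$ and a monoid morphism $h:\Sigma^*\to M$ into a finite monoid. $D_L(x)=\{(u,v):uxv\in L\}$; $x\equiv_L y$ iff $D_L(x)=D_L(y)$. The relative syntactic congruence $\theta_{L,h}$ is: $x\,\theta_{L,h}\,y$ iff $x\equiv_L y$ and $h(x)=h(y)$; its classes $[x]$ are called relative classes.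 A relative class is live if $D_L(x)\neq\varnothing$ for its members. The unit class is $[\varepsilon]$; non-unit means different from it. $(L,h)$ is unit-separated if $[\varepsilon]=\{\varepsilon\}$. $L$ is $h$-substitutable if $h(x)=h(y)$ and $D_L(x)\cap D_L(y)\ne\varnothing$ imply $x\equiv_Ly$. For relative classes: $X\cdot Y=\{xy:x\in X,y\in Y\}$ and $X*Y=[xy]$ for any $x\in X,y\in Y$ (quotient product). A relative prime is a live non-unit relative class $P$ such that whenever $P=X\cdot Y$ (equality of sets) for relative classes $X,Y$, one of $X,Y$ is $[\varepsilon]$; $\mathcal P$ is the set of relative primes. An exact factorization of $X$ into relative primes is a finite nonempty sequence in $\mathcal P$ whose setwise product equals $X$. For $P\in\mathcal P$ and $\alpha=P_1\cdots P_k\in\mathcal P^{k}$, $k\ge2$, the production $P\to\alpha$ is correct if $P_1*\cdots*P_k=P$; $\alpha$ is pleonastic if some proper contiguous block of $\alpha$ of length $\ge2$ has quotient product in $\mathcal P$; a correct production is valid if its right-hand side is not pleonastic. $\mathrm{Val}_P=\{\alpha:P\to\alpha\text{ valid}\}$ is a language over the alphabet $\mathcal P$ (the valid-return language of $P$). FRP means $\mathcal P$ is finite and the set of all valid productions is finite. FSRP means $\mathcal P$ is finite and every $\mathrm{Val}_P$ is a regular language over $\mathcal P$. Notation for the claim. For $s\in M_{36}\setminus\{1\}$: $\mathsf M_s=\{u\in\{a,b\}^+:h_{36}(u)=s\}$ and $W_s=\{c^iud^i:i\ge1,\ u\in\mathsf M_s\}$; $C=\{c\}$, $D=\{d\}$.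 $\mathsf P_{36}=\{s\in M_{36}\setminus\{1\}:\mathsf M_s\text{ is a relative prime}\}$ (equivalently for $(L^{\mathrm{wrap}},h^{\mathrm{wrap}})$ or for $(\{a,b\}^+,h_{36})$). The relative primes of $(L^{\mathrm{wrap}},h^{\mathrm{wrap}})$ are $C$, $D$, the $\mathsf M_p$ ($p\in\mathsf P_{36}$), and the $W_s$ ($s\ne1$). Let $\mathcal A=\{\mathsf M_p:p\in\mathsf P_{36}\}$ and let $\mu:\mathcal A^*\to M_{36}$ be the morphism with $\mu(\mathsf M_p)=p$. Put $\mathrm{Corr}^{\mathrm{mid}}=\{\beta\in\mathcal A^*:|\beta|\ge2,\ \mu(\beta)\in\mathsf P_{36}\}$ and, for $s\ne1$, $\mathsf I_s=\bigl(\mu^{-1}(s)\cap\mathcal A^+\bigr)\setminus\mathcal A^*\,\mathrm{Corr}^{\mathrm{mid}}\,\mathcal A^*$. *)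

(* Defs.v *)
From HB Require Import structures.
From mathcomp Require Import all_boot.
From mathcomp Require Import mathcomp_extra boolp classical_sets cardinality.

Set Implicit Arguments.
Unset Strict Implicit.
Unset Printing Implicit Defensive.

Local Open Scope quotient_scope.
Local Open Scope group_scope.
Local Open Scope classical_set_scope.

Definition star (T : eqType) (A : set T) : set (seq T) :=
  [set w | {in w, forall x, A x}].

Definition plus (T : eqType) (A : set T) : set (seq T) :=
  [set w | star A w /\ w <> [::]].

Definition conc (T : Type) (K L : set (seq T)) : set (seq T) :=
  [set u ++ v | u in K & v in L].

(* [A] is the finite alphabet; it is a set rather than a type, because it will
   also be a finite set of relative classes.  The automaton is only run on
   words over [A]. *)
Definition regular (T : eqType) (A : set T) (K : set (seq T)) : Prop :=
  [/\ finite_set A, K `<=` star A &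
      exists (Q : finType) (q0 : Q) (delta : Q -> T -> Q) (F : {set Q}),
        forall w, star A w -> (K w <-> foldl delta q0 w \in F)].

Record cfg (T : eqType) := Cfg {
  nonterm : finType;
  start : nonterm;
  rules : seq (nonterm * seq (nonterm + T))
}.

Section Derivations.
Variables (T : eqType) (G : cfg T).

Inductive derives : seq (nonterm G + T) -> seq (nonterm G + T) -> Prop :=
| DerivesRefl x : derives x x
| DerivesStep x u N y v :
    derives x (u ++ inl N :: v) -> (N, y) \in rules G ->
    derives x (u ++ y ++ v).

Definition cfg_language : set (seq T) :=
  [set w | derives [:: inl (start G)] (map inr w)].

End Derivations.

Definition context_free (T : eqType) (L : set (seq T)) : Prop :=
  exists G : cfg T, cfg_language G = L.

Record wordmorph (S : Type) (M : monoidType) := WordMorph {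
  wm_fun :> seq S -> M;
  wm_nil : wm_fun [::] = 1;
  wm_cat : forall u v, wm_fun (u ++ v) = wm_fun u * wm_fun v
}.

Section FreeExtension.
Variables (S : Type) (M : monoidType) (f : S -> M).

Definition free_fun (w : seq S) : M := \prod_(x <- w) f x.

Lemma free_nil : free_fun [::] = 1.
Proof. by rewrite /free_fun big_nil. Qed.

Lemma free_cat u v : free_fun (u ++ v) = free_fun u * free_fun v.
Proof. by rewrite /free_fun big_cat. Qed.

Definition free_ext : wordmorph S M := WordMorph free_nil free_cat.

End FreeExtension.

Section Relative.
Variables (S : finType) (M : monoidType).
Variables (L : set (seq S)) (h : wordmorph S M).

Notation word := (seq S).
Notation class := (set (seq S)).

Definition ctx (x : word) : set (word * word) :=
  [set uv | L (uv.1 ++ x ++ uv.2)].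

Definition syn_equiv (x y : word) : Prop := ctx x = ctx y.

Definition theta (x y : word) : Prop := syn_equiv x y /\ h x = h y.

Definition cl (x : word) : class := [set y | theta x y].

Definition relclass : set class := range cl.

Definition live (X : class) : Prop := forall x, X x -> ctx x !=set0.

Definition unitcl : class := cl [::].

Definition unit_separated : Prop := unitcl = [set [::]].

Definition substitutable : Prop :=
  forall x y, h x = h y -> ctx x `&` ctx y !=set0 -> syn_equiv x y.

(* [conc] is the setwise product; [qprod] is the quotient product [X * Y],
   which is [cl (x ++ y)] for any [x] in [X] and [y] in [Y] (see [qprodE]). *)
Definition qprod (X Y : class) : class :=
  \bigcup_(x in X) \bigcup_(y in Y) cl (x ++ y).

Lemma theta_refl x : theta x x. Proof. by []. Qed.

Lemma theta_cat x x' y y' :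
  theta x x' -> theta y y' -> theta (x ++ y) (x' ++ y').
Proof.
move=> [exx hx] [eyy hy]; split; last by rewrite !wm_cat hx hy.
apply/seteqP; split=> -[u v] /= Lw.
- have : ctx x (u, y ++ v) by rewrite /ctx /= catA in Lw *; rewrite -!catA in Lw *.
  rewrite exx /ctx /= => Lw1.
  have : ctx y (u ++ x', v) by rewrite /ctx /= -!catA.
  by rewrite eyy /ctx /= -!catA.
- have : ctx x' (u, y' ++ v) by rewrite /ctx /= -!catA in Lw *.
  rewrite -exx /ctx /= => Lw1.
  have : ctx y' (u ++ x, v) by rewrite /ctx /= -!catA.
  by rewrite -eyy /ctx /= -!catA.
Qed.

Lemma qprodE x y : qprod (cl x) (cl y) = cl (x ++ y).
Proof.
apply/seteqP; split=> [z [x' xx' [y' yy' [e1 h1]]]|z xyz].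
  have [e2 h2] := theta_cat xx' yy'.
  by split; [exact: etrans e2 e1 | exact: etrans h2 h1].
by exists x; [exact: theta_refl | exists y; [exact: theta_refl |]].
Qed.

(* The empty products below are the neutral elements of [conc] and, on relative
   classes, of [qprod]; they are never used as products of empty sequences. *)
Definition set_prod (s : seq class) : class := foldr (@conc S) [set [::]] s.
Definition quot_prod (s : seq class) : class := foldr qprod unitcl s.

Definition relprime : set class :=
  [set P | [/\ relclass P, live P, P <> unitcl &
     forall X Y, relclass X -> relclass Y ->
       P = conc X Y -> X = unitcl \/ Y = unitcl]].

Definition exact_factorization (X : class) (s : seq class) : Prop :=
  plus relprime s /\ set_prod s = X.

Definition correct (P : class) (alpha : seq class) : Prop :=
  [/\ star relprime alpha, (2 <= size alpha)%N & quot_prod alpha = P].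

Definition pleonastic (alpha : seq class) : Prop :=
  exists l m r, [/\ alpha = l ++ m ++ r, (2 <= size m < size alpha)%N &
                    relprime (quot_prod m)].

Definition Val (P : class) : set (seq class) :=
  [set alpha | correct P alpha /\ ~ pleonastic alpha].

Definition FRP : Prop :=
  finite_set relprime /\
  finite_set [set pr : class * seq class | relprime pr.1 /\ Val pr.1 pr.2].

Definition FSRP : Prop :=
  finite_set relprime /\ forall P, relprime P -> regular relprime (Val P).

End Relative.

Definition submonoid (M : monoidType) (A : set M) : Prop :=
  A 1 /\ forall x y, A x -> A y -> A (x * y).

Definition generated_submonoid (M : monoidType) (G : set M) : set M :=
  smallest (@submonoid M) G.

Definition congruence (M : monoidType) (R : set (M * M)) : Prop :=
  [/\ forall x, R (x, x),
      forall x y, R (x, y) -> R (y, x),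
      forall x y z, R (x, y) -> R (y, z) -> R (x, z) &
      forall x x' y y', R (x, x') -> R (y, y') -> R (x * y, x' * y')].

Definition generated_congruence (M : monoidType) (G : set (M * M)) :
  set (M * M) := smallest (@congruence M) G.

Lemma submonoid_generated (M : monoidType) (G : set M) :
  submonoid (generated_submonoid G).
Proof.
split=> [A [[A1 _] _]|x y Ax Ay A AG] //.
by have [[_ AM] _] := AG; apply: AM; [exact: Ax | exact: Ay].
Qed.

Lemma congruence_generated (M : monoidType) (G : set (M * M)) :
  congruence (generated_congruence G).
Proof.
split=> [x R [[rR _ _ _] _]|x y Rxy R RG|x y z Rxy Ryz R RG|x x' y y' Rx Ry R RG].
- exact: rR.
- by have [[_ sR _ _] _] := RG; apply: sR; exact: Rxy.
- by have [[_ _ tR _] _] := RG; apply: (tR _ y); [exact: Rxy | exact: Ryz].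
- by have [[_ _ _ mR] _] := RG; apply: mR; [exact: Rx | exact: Ry].
Qed.

(* An alias with composition from left to right, since ['I_4] is itself a group
   and [{ffun _ -> 'I_4}] therefore already carries a pointwise product. *)
Definition transf (Q : finType) : Type := {ffun Q -> Q}.

Section Transf.
Variable Q : finType.

HB.instance Definition _ := Finite.copy (transf Q) {ffun Q -> Q}.

Definition transf_mul (f g : transf Q) : transf Q := [ffun x => g (f x)].
Definition transf_one : transf Q := [ffun x => x].

Lemma transf_mulA : associative transf_mul.
Proof. by move=> f g k; apply/ffunP => x; rewrite !ffunE. Qed.

Lemma transf_mul1 : left_id transf_one transf_mul.
Proof. by move=> f; apply/ffunP => x; rewrite !ffunE. Qed.

Lemma transf_mulr1 : right_id transf_one transf_mul.
Proof. by move=> f; apply/ffunP => x; rewrite !ffunE. Qed.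

HB.instance Definition _ :=
  isMonoid.Build (transf Q) transf_mulA transf_mul1 transf_mulr1.

End Transf.

Definition Q0 : finType := 'I_4.

Definition tuple4 (x0 x1 x2 x3 : nat) : transf Q0 :=
  [ffun x : Q0 => inord (nth 0 [:: x0; x1; x2; x3] x)]%N.

Definition tau_a : transf Q0 := tuple4 1 2 0 0.
Definition tau_b : transf Q0 := tuple4 1 3 1 0.

Definition S0 : {pred transf Q0} :=
  [pred f | `[< generated_submonoid [set tau_a; tau_b] f >]].

Lemma S0_closed : monoid_closed S0.
Proof.
have [S1 SM] := submonoid_generated [set tau_a; tau_b].
split=> [|x y]; rewrite !inE; first exact: S1.
by move=> Sx Sy; exact: SM.
Qed.

Lemma tau_a_in : tau_a \in S0.
Proof. by apply/asboolP => A [_]; apply; left. Qed.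

Lemma tau_b_in : tau_b \in S0.
Proof. by apply/asboolP => A [_]; apply; right. Qed.

Definition M0 : Type := {f : transf Q0 | f \in S0}.

HB.instance Definition _ := Finite.on M0.
HB.instance Definition _ := SubType.on M0.
HB.instance Definition _ :=
  SubChoice_isSubMonoid.Build (transf Q0) S0 M0 S0_closed.

Variant ab : Set := la | lb.

Definition ab_bool (x : ab) : bool := if x is la then true else false.
Definition bool_ab (b : bool) : ab := if b then la else lb.
Lemma ab_boolK : cancel ab_bool bool_ab. Proof. by case. Qed.
HB.instance Definition _ := Countable.copy ab (can_type ab_boolK).
HB.instance Definition _ : isFinite ab := CanIsFinite ab_boolK.

Definition h0 : wordmorph ab M0 :=
  free_ext (fun x : ab =>
    match x with
    | la => Sub tau_a tau_a_in
    | lb => Sub tau_b tau_b_in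
    end).

Definition sim0_set : set (M0 * M0) :=
  generated_congruence
    [set (h0 [:: la; lb], h0 [:: la; lb; la; la; la; lb])].

Lemma sim0_congruence : congruence sim0_set.
Proof. exact: congruence_generated. Qed.

Definition sim0 : rel M0 := fun x y => `[< sim0_set (x, y) >].

Lemma sim0_refl : reflexive sim0.
Proof. by move=> x; apply/asboolP; have [rR _ _ _] := sim0_congruence. Qed.

Lemma sim0_sym : symmetric sim0.
Proof.
have [_ sR _ _] := sim0_congruence.
by move=> x y; apply/asboolP/asboolP; exact: sR.
Qed.

Lemma sim0_trans : transitive sim0.
Proof.
have [_ _ tR _] := sim0_congruence.
by move=> y x z /asboolP xy /asboolP yz; apply/asboolP; apply: tR xy yz.
Qed.

Canonical sim0_equiv := EquivRel sim0 sim0_refl sim0_sym sim0_trans.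

Definition M36 : Type := {eq_quot sim0}.

HB.instance Definition _ := EqQuotient.on M36.
HB.instance Definition _ := Choice.on M36.
HB.instance Definition _ : isCountable M36 :=
  CanIsCountable (@reprK _ M36).
HB.instance Definition _ : isFinite M36 := CanIsFinite (@reprK _ M36).

Definition M36_mul (x y : M36) : M36 := \pi_M36 (repr x * repr y)%g.
Definition M36_one : M36 := \pi_M36 1%g.

Lemma pi_M36P (x y : M0) : \pi_M36 x = \pi_M36 y <-> sim0_set (x, y).
Proof.
split=> [/(introT (eqmodP sim0_equiv x y)) /asboolP // | xy].
by apply: (elimT (eqmodP sim0_equiv x y)); apply/asboolP.
Qed.

Lemma pi_mul (x y : M0) :
  M36_mul (\pi_M36 x) (\pi_M36 y) = \pi_M36 (x * y)%g.
Proof.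
have [_ _ _ mR] := sim0_congruence.
by apply/pi_M36P; apply: mR; apply/pi_M36P; rewrite reprK.
Qed.

Lemma M36_mulA : associative M36_mul.
Proof.
move=> x y z; rewrite -[x]reprK -[y]reprK -[z]reprK.
by rewrite !pi_mul !reprK mulgA.
Qed.

Lemma M36_mul1 : left_id M36_one M36_mul.
Proof. by move=> x; rewrite -[x]reprK pi_mul mul1g. Qed.

Lemma M36_mulr1 : right_id M36_one M36_mul.
Proof. by move=> x; rewrite -[x]reprK pi_mul mulg1. Qed.

HB.instance Definition _ := isMonoid.Build M36 M36_mulA M36_mul1 M36_mulr1.

Definition pi0 (x : M0) : M36 := \pi_M36 x.

Lemma h36_nil : pi0 (h0 [::]) = 1.
Proof. by rewrite wm_nil. Qed.

Lemma h36_cat u v : pi0 (h0 (u ++ v)) = pi0 (h0 u) * pi0 (h0 v).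
Proof. by rewrite wm_cat; exact/esym/pi_mul. Qed.

Definition h36 : wordmorph ab M36 := WordMorph h36_nil h36_cat.

Variant Gamma : Set := ga | gb | gc | gd.

Definition Gamma_bool (x : Gamma) : bool * bool :=
  match x with
  | ga => (false, false) | gb => (false, true)
  | gc => (true, false) | gd => (true, true)
  end.
Definition bool_Gamma (p : bool * bool) : Gamma :=
  match p with
  | (false, false) => ga | (false, true) => gb
  | (true, false) => gc | (true, true) => gd
  end.
Lemma Gamma_boolK : cancel Gamma_bool bool_Gamma. Proof. by case. Qed.
HB.instance Definition _ := Countable.copy Gamma (can_type Gamma_boolK).
HB.instance Definition _ : isFinite Gamma := CanIsFinite Gamma_boolK.

Definition emb (x : ab) : Gamma := match x with la => ga | lb => gb end.

Definition h36hat : wordmorph Gamma M36 :=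
  free_ext (fun x : Gamma =>
    match x with
    | ga => h36 [:: la]
    | gb => h36 [:: lb]
    | gc | gd => 1
    end).

Lemma h36hat_emb (w : seq ab) : h36hat (map emb w) = h36 w.
Proof.
elim: w => [|x w IHw]; first by rewrite !wm_nil.
rewrite -cat1s map_cat !wm_cat IHw; congr (_ * _).
by rewrite /= /free_fun big_seq1; case: x.
Qed.

Definition maxbool : Type := bool.
HB.instance Definition _ := Finite.on maxbool.
HB.instance Definition _ := isMonoid.Build maxbool orbA orFb orbF.

Definition E : Type := (maxbool * maxbool)%type.
HB.instance Definition _ := Finite.on E.
HB.instance Definition _ := Monoid.on E.

Definition chi (w : seq Gamma) : E := (gc \in w, gd \in w).

Definition hwrap_fun (w : seq Gamma) : M36 * E := (h36hat w, chi w).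

Lemma hwrap_nil : hwrap_fun [::] = 1.
Proof. by rewrite /hwrap_fun wm_nil. Qed.

Lemma hwrap_cat u v : hwrap_fun (u ++ v) = hwrap_fun u * hwrap_fun v.
Proof. by rewrite /hwrap_fun wm_cat /chi !mem_cat. Qed.

Definition hwrap : wordmorph Gamma (M36 * E)%type :=
  WordMorph hwrap_nil hwrap_cat.

Definition Lab : set (seq ab) := [set w | w <> [::]].

Definition wrap (n : nat) (w : seq ab) : seq Gamma :=
  nseq n gc ++ map emb w ++ nseq n gd.

Definition Lwrap : set (seq Gamma) :=
  [set x | exists n w, Lab w /\ x = wrap n w].

Definition Ccl : set (seq Gamma) := [set [:: gc]].
Definition Dcl : set (seq Gamma) := [set [:: gd]].

Definition Mab (s : M36) : set (seq ab) := [set u | Lab u /\ h36 u = s].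

(* The inclusion of {a,b}* in Gamma*, on classes. *)
Definition embcl (X : set (seq ab)) : set (seq Gamma) := map emb @` X.

Definition Mcl (s : M36) : set (seq Gamma) := embcl (Mab s).

Definition Wcl (s : M36) : set (seq Gamma) :=
  [set x | exists i u, [/\ (1 <= i)%N, Mab s u & x = wrap i u]].

Definition P36 : set M36 := [set s | s <> 1 /\ relprime Lwrap hwrap (Mcl s)].

Definition Amid : set (set (seq Gamma)) := Mcl @` P36.

(* Words over [Amid] are multiplied through [p] for the letter [Mcl p]
   (see [mu_Mcl]); the value of [mu] outside [star Amid] is irrelevant. *)
Definition mu_letter (X : set (seq Gamma)) : M36 :=
  xget (1 : M36) [set p | P36 p /\ Mcl p = X].

Definition mu : wordmorph (set (seq Gamma)) M36 := free_ext mu_letter.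

Lemma mu_Mcl p : P36 p -> mu [:: Mcl p] = p.
Proof.
move=> Pp; rewrite /= /free_fun big_seq1; apply: xget_unique => // q [_ Mqp].
have [_ [[x _ Mx] _ _ _]] := Pp.
have : Mcl p x by rewrite -Mx; exact: theta_refl.
move=> Mpx; have : Mcl q x by rewrite Mqp.
case: Mpx => u [_ <-] <- [v [_ <-]] vu.
by rewrite -!h36hat_emb vu.
Qed.

Definition Corr_mid : set (seq (set (seq Gamma))) :=
  [set beta | [/\ star Amid beta, (2 <= size beta)%N & P36 (mu beta)]].

Definition Icl (s : M36) : set (seq (set (seq Gamma))) :=
  ((mu @^-1` [set s]) `&` plus Amid) `\`
  conc (conc (star Amid) Corr_mid) (star Amid).

(* Main.v *)
(* Write [M_s] for the words over [{a, b}] with image [s].  The live relative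
   classes are the sets [c^i Y d^j] with [i = 0] or [j = 0] and [Y] one of
   [{empty word}], [M_s], [W_s]: the context set of a live word [c^i u d^j] is
   determined by [i - j] and by which letters occur, because membership in
   [Lwrap] means being sorted, balanced in [c] and [d], and not in [c^* d^*].
   A product of primes containing a live word therefore reads [C^i N D^j] where
   [N] is a sequence of [M_p]'s or a single [W_s]; comparing the numbers of [c]
   and [d] gives the factorizations and the valid productions, everything else
   being a question about [M36].

   [M36] has 36 elements.  A factorization of [M_s] is in particular one of the
   shortest word of [M_s], so only finitely many sequences have to be tested,
   and all but one of them miss a short word of [M_s]; equalities of the form
   [M_s M_t = M_st] are checked by exploring a deterministic automaton.

   Regularity: [Val_P] is a Boolean combination of concatenations of languages
   recognized by [mu].  FRP fails because there are a prime [p] and a nonprime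
   [s] with [p p = s p = s], so that [C M_p^n D] is valid for all [n >= 2]. *)
Require Import Defs.
From mathcomp Require Import all_boot.
From mathcomp Require Import zify.
From mathcomp Require Import mathcomp_extra boolp classical_sets cardinality.

Set Implicit Arguments.
Unset Strict Implicit.
Unset Printing Implicit Defensive.

Local Open Scope classical_set_scope.

(** * The Cayley graph of [M36] *)

(* The right Cayley graph of [M36]: elements are numbered in the shortlex order
   of their least representatives, and [step k x] is the [k]-th element times
   the generator [x]. *)
Definition step (k : nat) (x : ab) : nat :=
  nth 0 (if x is la
         then [:: 1; 3; 5; 7; 9; 11; 11; 1; 15; 17; 17; 19; 20; 19; 22; 24; 24;
                  25; 18; 5; 27; 27; 28; 28; 29; 9; 30; 32; 33; 15; 34; 34; 20;
                  22; 35; 30]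
         else [:: 2; 4; 6; 8; 10; 12; 13; 14; 16; 18; 17; 14; 21; 2; 23; 18; 24;
                  4; 18; 26; 18; 27; 18; 28; 8; 4; 31; 12; 14; 8; 18; 34; 12;
                  14; 26; 26]) k.

Definition run (w : seq ab) : nat := foldl step 0 w.

Fixpoint words (n : nat) : seq (seq ab) :=
  if n is n'.+1
  then [::] :: [seq rcons w x | w <- words n', x <- [:: la; lb]] else [:: [::]].

Definition rep_of (k : nat) : seq ab :=
  let ws := words 8 in nth [::] ws (find (fun w => run w == k) ws).
Definition reps : seq (seq ab) := Eval vm_compute in map rep_of (iota 0 36).
Definition rep (k : nat) : seq ab := nth [::] reps k.

Definition mulk (k l : nat) : nat := foldl step k (rep l).

Lemma all_iota (P : pred nat) n :
  all P (iota 0 n) -> forall k, k < n -> P k.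
Proof. by move=> /allP H k lk; apply: H; rewrite mem_iota. Qed.

Lemma run_rcons w x : run (rcons w x) = step (run w) x.
Proof. by rewrite /run -cats1 foldl_cat. Qed.

Lemma run_lt w : run w < 36.
Proof.
have H : all (fun k => (step k la < 36) && (step k lb < 36)) (iota 0 36).
  by vm_compute.
elim/last_ind: w => [|w x IHw] //; rewrite run_rcons.
by case/andP: (all_iota H IHw); case: x.
Qed.

Lemma run_rep k : k < 36 -> run (rep k) = k.
Proof.
have H : all (fun k => run (rep k) == k) (iota 0 36) by vm_compute.
by move=> lk; apply/eqP/(all_iota H).
Qed.

(** A finite check shows that [mulk k] commutes with right multiplication by a generator; induction
    on the last letter extends this to words and makes [run] multiplicative. *)
Lemma foldl_run k w : k < 36 -> foldl step k w = mulk k (run w).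
Proof.
have H : all (fun k => all (fun l => all (fun x =>
    mulk k (step l x) == step (mulk k l) x) [:: la;
      lb]) (iota 0 36)) (iota 0 36).
  by vm_compute.
move=> lk; elim/last_ind: w => [|w x IHw]; first by [].
rewrite run_rcons -cats1 foldl_cat /= IHw; apply/esym/eqP.
have /and3P[] := all_iota (all_iota H lk) (run_lt w); by case: x.
Qed.

Lemma run_cat u v : run (u ++ v) = mulk (run u) (run v).
Proof. by rewrite /run foldl_cat foldl_run ?run_lt. Qed.

(** No edge of the graph enters state 0, so only the empty word has value 1. *)
Lemma run_eq0 w : run w = 0 -> w = [::].
Proof.
have H : all (fun k => (step k la != 0) && (step k lb != 0)) (iota 0 36).
  by vm_compute.
case/lastP: w => [|w x] //; rewrite run_rcons => e.
have /andP[ha hb] := all_iota H (run_lt w).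
by case: x e => e; [rewrite e in ha | rewrite e in hb].
Qed.

(** * The transformations of [M0] and the congruence [sim0] *)

Definition tstep (q : nat) (x : ab) : nat :=
  nth 0 (if x is la then [:: 1; 2; 0; 0] else [:: 1; 3; 1; 0]) q.

(** The value table of [h0 w], kept on plain naturals so that [vm_compute] can compare
    transformations. *)
Definition code (w : seq ab) : seq nat :=
  [seq foldl tstep q w | q <- iota 0 4].

Lemma tstep_lt q x : tstep q x < 4.
Proof. by case: x; case: q => [|[|[|[|q]]]] //; rewrite /tstep /= nth_nil. Qed.

Lemma foldl_tstep_lt q w : q < 4 -> foldl tstep q w < 4.
Proof. by elim: w q => //= x w IHw q _; apply: IHw; apply: tstep_lt. Qed.

Lemma h0E w (i : Q0) : (val (h0 w) : transf Q0) i = inord (foldl tstep i w).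
Proof.
elim/last_ind: w => [|w x IHw].
  by rewrite wm_nil /= inord_val; transitivity (transf_one Q0 i) => //;
    rewrite ffunE.
rewrite -cats1 wm_cat foldl_cat /=.
transitivity (transf_mul (val (h0 w)) (val (h0 [:: x])) i) => //.
rewrite ffunE IHw /= /free_fun big_seq1.
by case: x; rewrite /= ffunE inordK // foldl_tstep_lt.
Qed.

Lemma h0_code u v : h0 u = h0 v <-> code u = code v.
Proof.
split=> [e|e].
  apply/eq_in_map => q; rewrite mem_iota /= => lq.
  have := h0E u (Ordinal lq : Q0);
    rewrite e h0E /= => /(congr1 (@nat_of_ord _)).
  by rewrite !inordK ?foldl_tstep_lt.
apply/val_inj/ffunP => i; rewrite !h0E; congr inord.
have /eq_in_map := e; apply; rewrite mem_iota /=; exact: ltn_ord.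
Qed.

(* [h36 (l ++ ab ++ r) = h36 (l ++ abaaab ++ r)] for each of these pairs
   [(l, r)]; with [reps], the words [l ++ abaaab ++ r] represent the 64 elements
   of [M0]. *)
Definition pumps : seq (seq ab * seq ab) :=
  [seq (l, r) | l <- [:: [::]; [:: la]; [:: lb]; [:: la; la]; [:: lb; la; la]],
                r <- [:: [::]; [:: la]; [:: lb]; [:: la; la]; [:: la; la; la]]]
  ++ [:: ([:: la; lb], [::]); ([:: la; lb], [:: la; la; la]);
         ([:: la; lb], [:: la; la; la; lb; la; la])].

Definition pumped (lr : seq ab * seq ab) : seq ab :=
  lr.1 ++ [:: la; lb; la; la; la; lb] ++ lr.2.

Definition reps0 : seq (seq ab) := reps ++ map pumped pumps.

(** Up to [code] and [run], the list [reps0] is closed under appending a letter, so induction on the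
    last letter covers all words. *)
Lemma reps0P u : exists2 w, w \in reps0 & code u = code w /\ run u = run w.
Proof.
have H : all (fun w => all (fun x =>
    has (fun w' => (code w' == code (rcons w x)) && (run w' == run (rcons w x)))
        reps0) [:: la; lb]) reps0 by vm_compute.
elim/last_ind: u => [|u x [w wr [ec er]]].
  by exists [::]; first by vm_compute.
have /andP[Ha /andP[Hb _]] := allP H w wr.
have {Ha Hb}/hasP[w' w'r /andP[/eqP ec' /eqP er']] :
    has (fun w' => (code w' == code (rcons w x)) &&
                   (run w' == run (rcons w x))) reps0 by case: x.
exists w'; first exact: w'r.
rewrite ec' er' !run_rcons er; split=> //.
apply/eq_in_map => q qI; rewrite -!cats1 !foldl_cat /=.
by move/eq_in_map: ec => ->.
Qed.

(** After [reps0P] this is a check on pairs of listed words; it makes [run] factor through [M0]. *)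
Lemma code_run u v : code u = code v -> run u = run v.
Proof.
have H : all (fun w => all (fun w' => (code w == code w') ==> (run w == run w'))
    reps0) reps0 by vm_compute.
have [w wr [ec ->]] := reps0P u; have [w' w'r [ec' ->]] := reps0P v.
rewrite ec ec' => /eqP e; apply/eqP.
by have := allP (allP H w wr) w' w'r; rewrite e.
Qed.

Lemma h0_surj (f : M0) : exists u, h0 u = f.
Proof.
have: `[< generated_submonoid [set tau_a; tau_b] (val f) >] by exact: (valP f).
move=> /asboolP; set A := [set g | exists u, val (h0 u) = g].
move=> /(_ A)[|u e]; last by exists u; apply: val_inj.
split; [split|] => /=.
- by exists [::]; rewrite wm_nil.
- by move=> _ _ [u <-] [v <-]; exists (u ++ v); rewrite wm_cat.
- by move=> _ [] ->; [exists [:: la] | exists [:: lb]];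
    rewrite /= /free_fun big_seq1.
Qed.

Lemma h36_surj s : exists u, h36 u = s.
Proof.
by have [u e] := h0_surj (repr s); exists u; rewrite -[RHS]reprK -e.
Qed.

Lemma h36_code u v : code u = code v -> h36 u = h36 v.
Proof. by move=> /h0_code e; congr pi0. Qed.

Lemma h36_pump l r :
  h36 (l ++ [:: la; lb] ++ r) = h36 (l ++ [:: la; lb; la; la; la; lb] ++ r).
Proof.
rewrite !wm_cat; congr (_ * (_ * _))%g; apply/pi_M36P => R [_]; exact.
Qed.

(** By [reps0P] only listed words matter. Those in [reps] are their own representatives; a pumped
    word is rewritten by the defining relation into a word with the code of its representative. *)
Lemma h36_rep u : h36 u = h36 (rep (run u)).
Proof.
have H : all (fun lr => code (lr.1 ++ [:: la; lb] ++ lr.2) ==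
                        code (rep (run (pumped lr)))) pumps by vm_compute.
have R : all (fun w => rep (run w) == w) reps by vm_compute.
have [w wr [ec ->]] := reps0P u; rewrite (h36_code ec).
move: wr; rewrite mem_cat => /orP[wr|/mapP[lr lrP ->]].
  by rewrite (eqP (allP R w wr)).
by rewrite -h36_pump; apply: h36_code; apply/eqP/(allP H).
Qed.

(** [R] relates two elements when all words for them have the same [run]. It is a congruence
    containing the generating pair, so it contains the least one. *)
Lemma sim0_run u v : sim0_set (h0 u, h0 v) -> run u = run v.
Proof.
pose R : set (M0 * M0) :=
  [set p | forall x y, h0 x = p.1 -> h0 y = p.2 -> run x = run y].
move=> /(_ R); apply => //; split; [split|] => /=.
- by move=> f x y /= <- /h0_code/code_run.
- by move=> f g fg x y /= ex ey; apply/esym/fg.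
- move=> f g k fg gk x y /= ex ey.
  have [z ez] := h0_surj g.
  by rewrite (fg x z) // (gk z y).
- move=> f f' g g' ff gg x y /= ex ey.
  have [[u1 e1] [v1 e1']] := (h0_surj f, h0_surj f').
  have [[u2 e2] [v2 e2']] := (h0_surj g, h0_surj g').
  have -> : run x = run (u1 ++ u2).
    by apply/code_run/h0_code; rewrite wm_cat e1 e2.
  have -> : run y = run (v1 ++ v2).
    by apply/code_run/h0_code; rewrite wm_cat e1' e2'.
  by rewrite !run_cat (ff u1 v1) // (gg u2 v2).
- move=> _ -> x y /= /h0_code/code_run -> /h0_code/code_run ->.
  by vm_compute.
Qed.

Lemma h36_run u v : h36 u = h36 v <-> run u = run v.
Proof.
split=> [/pi_M36P/sim0_run //|e].
by rewrite h36_rep e -h36_rep.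
Qed.

Lemma h36_eq1 u : h36 u = 1%g -> u = [::].
Proof. by rewrite -(wm_nil h36) => /h36_run/run_eq0. Qed.

(** * Exact products and primes over [{a, b}] *)

Lemma concA (T : Type) : associative (@conc T).
Proof.
move=> A B C; apply/seteqP; split=> w.
  move=> [u Au [_ [v Bv [t Ct <-]] <-]]; rewrite catA.
  by exists (u ++ v); [exists u => //; exists v | exists t].
move=> [_ [u Au [v Bv <-]] [t Ct <-]]; rewrite -catA.
by exists u => //; exists (v ++ t) => //; exists v => //; exists t.
Qed.

Lemma conc1 (T : Type) (A : set (seq T)) : conc A [set [::]] = A.
Proof.
apply/seteqP; split=> [_ [u Au [_ -> <-]]|u Au]; first by rewrite cats0.
by exists u => //; exists [::] => //; rewrite cats0.
Qed.

Lemma conc1l (T : Type) (A : set (seq T)) : conc [set [::]] A = A.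
Proof.
apply/seteqP; split=> [_ [_ -> [u Au <-]]|u Au] //.
by exists [::] => //; exists u.
Qed.

Lemma set_prod_cat (T : finType) (s1 s2 : seq (set (seq T))) :
  set_prod (s1 ++ s2) = conc (set_prod s1) (set_prod s2).
Proof. by elim: s1 => [|X s1 /= ->]; rewrite ?conc1l // concA. Qed.

Lemma set_prod1 (T : finType) (X : set (seq T)) : set_prod [:: X] = X.
Proof. exact: conc1. Qed.

Definition el (k : nat) : M36 := h36 (rep k).

Lemma h36_el u : h36 u = el (run u). Proof. exact: h36_rep. Qed.

Lemma elP s : s <> 1%g -> exists2 k, 0 < k < 36 & s = el k.
Proof.
have [u <-] := h36_surj s; rewrite h36_el => ne1.
exists (run u) => //; rewrite run_lt andbT lt0n; apply/eqP => e.
by apply: ne1; rewrite e; exact: (wm_nil h36).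
Qed.

Definition kset (k : nat) : set (seq ab) := [set w | run w = k].

Lemma Mab_el k : 0 < k < 36 -> Mab (el k) = kset k.
Proof.
move=> /andP[k0 lk]; rewrite /kset; apply/seteqP; split=> w /=.
  by move=> [_ /h36_run ->]; rewrite run_rep.
move=> e; split; last by rewrite h36_el e.
by rewrite /Lab /= => w0; move: k0; rewrite -e w0.
Qed.

(** * Exactness of a product of two classes, by a deterministic automaton *)

Definition states : seq nat := iota 0 36.

(** Filtering [states] stores a set of suffix values as a canonical list, so that repeated automaton
    states are recognised by equality. *)
Definition split_step (s : nat) (p : nat * seq nat) (x : ab) : nat * seq nat :=
  let q := step p.1 x in
  let S := [seq step t x | t <- p.2] in
  (q, [seq t <- states | (t \in S) || (q == s) && (t == 0)]).

(* [(split_run s w).2] lists the [run v] for the splittings [w = u ++ v] with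
   [run u = s]. *)
Definition split_run (s : nat) : seq ab -> nat * seq nat :=
  foldl (split_step s) (0, [::]).

(** Breadth-first search with fuel [n]. Its output is only a candidate for the set of reachable
    states, which [exact] then verifies. *)
Fixpoint explore (s n : nat) (seen front : seq (nat * seq nat)) :=
  if n is n'.+1 then
    let new := [seq p <- undup [seq split_step s p x | p <- front, x <- [:: la;
      lb]]
               | p \notin seen] in
    if new is [::] then seen else explore s n' (new ++ seen) new
  else seen.

(** A certificate that every word of value [mulk s t] splits into words of values [s] and [t]: [l]
    contains the start, is closed under both letters, and has [t] among the suffix values wherever
    the whole word has that value. *)
Definition exact (s t : nat) : bool :=
  let l := explore s 36 [:: (0, [::])] [:: (0, [::])] in
  [&& (0, [::]) \in l,
      all (fun p => all (fun x => split_step s p x \in l) [:: la; lb]) l &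
      all (fun p => (p.1 == mulk s t) ==> (t \in p.2)) l].

Lemma split_run_rcons s w x :
  split_run s (rcons w x) = split_step s (split_run s w) x.
Proof. by rewrite /split_run -cats1 foldl_cat. Qed.

Lemma split_run1 s w : (split_run s w).1 = run w.
Proof.
elim/last_ind: w => [|w x IHw]; first by [].
by rewrite split_run_rcons run_rcons -IHw.
Qed.

Lemma split_step2 s p x t : t \in (split_step s p x).2 ->
  (exists2 t', t' \in p.2 & t = step t' x) \/ step p.1 x = s /\ t = 0.
Proof.
rewrite /split_step mem_filter => /andP[/orP[/mapP ?|/andP[/eqP ? /eqP ?]] _].
  by left.
by right; split.
Qed.

Lemma split_run2 s w t : t \in (split_run s w).2 ->
  exists u v, [/\ w = u ++ v, run u = s & run v = t].
Proof.
elim/last_ind: w t => [|w x IHw] t; first by [].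
rewrite split_run_rcons => /split_step2[[t' /IHw[u [v [-> us vt]]] ->]|[e ->]].
  by exists u, (rcons v x); rewrite run_rcons vt us -cats1 -catA cats1.
by exists (rcons w x), [::]; rewrite cats0 run_rcons -e split_run1.
Qed.

Lemma exact_split s t w : exact s t -> run w = mulk s t ->
  exists u v, [/\ w = u ++ v, run u = s & run v = t].
Proof.
rewrite /exact; move: (explore _ _ _ _) => l /and3P[l0 lS lT] e.
(* [l] is an invariant of the automaton, whatever [explore] computed. *)
have wl : split_run s w \in l.
  elim/last_ind: w {e} => [|w x IHw]; first exact: l0.
  by rewrite split_run_rcons; have /and3P[] := allP lS _ IHw; case: x.
apply: split_run2; move: (allP lT _ wl).
by rewrite split_run1 e eqxx.
Qed.

(** The compositions of [w]: all cuttings into nonempty blocks, where the first letter stands alone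
    or joins the next block. *)
Fixpoint comps (w : seq ab) : seq (seq (seq ab)) :=
  if w is x :: w' then
    flatten [seq ([:: x] :: c) :: (if c is v :: c' then [:: (x :: v) :: c']
      else [::])
            | c <- comps w']
  else [:: [::]].

Lemma compsP c : all (fun v => v != [::]) c -> c \in comps (flatten c).
Proof.
elim: c => [|v c IHc] //= /andP[v0 /IHc cc].
case: v v0 => // x v _; elim: v x => [|y v IHv] x /=.
  by apply/flattenP; eexists; [apply: map_f cc | rewrite mem_head].
apply/flattenP; eexists; first exact: map_f (IHv y).
by rewrite !inE eqxx orbT.
Qed.

(** * Primes and factorizations over [{a, b}] *)

Definition kprod (ks : seq nat) : set (seq ab) := set_prod (map kset ks).

(** Only the empty word has value 0, so nonzero values force nonempty blocks; membership in a
    product can thus be refuted by enumerating compositions. *)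
Lemma kprodP ks w : 0 \notin ks -> kprod ks w ->
  ks \in [seq map run c | c <- comps w].
Proof.
move=> ks0 H; suff [c [cw c0 ck]] : exists c,
    [/\ flatten c = w, all (fun v => v != [::]) c & map run c = ks].
  by rewrite -ck -cw; apply: map_f; apply: compsP.
elim: ks w ks0 H => [|k ks IHks] w /=; first by move=> _ ->; exists [::].
rewrite inE negb_or => /andP[k0 ks0] [u uk [v /(IHks _ ks0)[c [cv c0 ck]] <-]].
exists (u :: c); rewrite /= cv c0 uk ck andbT; split=> //.
by apply: contraNneq k0 => u0; rewrite -uk u0.
Qed.

Definition primes36 : seq nat :=
  [:: 1; 2; 4; 5; 9; 11; 12; 14; 17; 18; 19; 20; 22; 27; 28].

(* For each of the 20 other elements [k <> 1], a pair [(s, t)] such that the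
   language of [k] is the product of those of [s] and [t]. *)
Definition exact_pairs : seq (nat * nat) :=
  [:: (1, 1); (1, 3); (1, 4); (1, 9); (1, 10); (1, 17); (1, 25);
      (2, 2); (2, 6); (2, 14); (2, 22); (2, 23); (2, 28); (2, 33);
      (4, 2); (12, 2); (14, 2); (17, 1); (27, 1); (28, 1)].

(** Splits by [exact_pairs] until only primes remain. That the fuel 5 is enough is confirmed by
    [fact_check]. *)
Fixpoint fact_rec (n k : nat) : seq nat :=
  if n is n'.+1 then
    if k \in primes36 then [:: k] else
    let p := nth (0, 0) exact_pairs
               (find (fun p => mulk p.1 p.2 == k) exact_pairs) in
    fact_rec n' p.1 ++ fact_rec n' p.2
  else [::].
Definition fact : nat -> seq nat := fact_rec 5.

Lemma exact_pairs_exact : all (fun p => exact p.1 p.2) exact_pairs.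
Proof. by vm_compute. Qed.

(** The decrease in length of [rep] is the induction measure of [fact_exact]. *)
Lemma fact_check : all (fun k =>
  if k \in primes36 then fact k == [:: k] else
  has (fun p => [&& mulk p.1 p.2 == k, fact k == fact p.1 ++ fact p.2,
        0 < p.1 < 36, 0 < p.2 < 36, size (rep p.1) < size (rep k) &
        size (rep p.2) < size (rep k)])
      exact_pairs) (iota 1 35).
Proof. by vm_compute. Qed.

(* Every sequence of primes multiplying to [k] occurs among the factorizations
   of the word [rep k]; all but [fact k] miss some word of length at most 11.
   (Nested [if]s and [find], because [||] and [has] are strict for the VM.) *)
Definition words_of (k : nat) : seq (seq ab) :=
  [seq w <- words 11 | run w == k].

Definition missed (ws : seq (seq ab)) (ks : seq nat) : bool :=
  find (fun w => ks \notin [seq map run c | c <- comps w]) ws < size ws.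

Lemma fact_uniq_check : all (fun k => let ws := words_of k in
  all (fun c => let ks := map run c in
         if all (mem primes36) ks then
           if ks == fact k then true else missed ws ks
         else true)
      (comps (rep k))) (iota 1 35).
Proof. by vm_compute. Qed.

(** A product of two classes equal to that of [k] must cut [rep k] into two blocks, so the two-block
    compositions of this one word give all candidates. *)
Lemma prime_check : all (fun k => let ws := words_of k in
  all (fun c => let ks := map run c in
         if size ks == 2 then missed ws ks else true)
      (comps (rep k))) primes36.
Proof. by vm_compute. Qed.

(* Otherwise unification unfolds [fact]. *)
#[local] Opaque fact.

Lemma missedP k ks : missed (words_of k) ks -> 0 \notin ks ->
  kprod ks <> kset k.
Proof.
rewrite /missed -has_find => /hasP[v]; rewrite mem_filter => /andP[/eqP vk _].
by move=> /negP nv ks0 e; apply: nv; apply: kprodP => //; rewrite e.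
Qed.

Lemma conc_kset s t : exact s t -> conc (kset s) (kset t) = kset (mulk s t).
Proof.
move=> est; apply/seteqP; split=> [_ [u us [v vt <-]]|w].
  by rewrite /kset /= run_cat us vt.
by move=> /(exact_split est)[u [v [-> us vt]]]; exists u => //; exists v.
Qed.

Lemma mem_iota1 k : 0 < k < 36 -> k \in iota 1 35.
Proof. by rewrite mem_iota. Qed.

Lemma exact_factor k : 0 < k < 36 -> k \notin primes36 ->
  exists p, [/\ 0 < p.1 < 36, 0 < p.2 < 36, kset k = conc (kset p.1) (kset p.2),
    fact k = fact p.1 ++ fact p.2 &
    size (rep p.1) < size (rep k) /\ size (rep p.2) < size (rep k)].
Proof.
move=> kI np; have := allP fact_check _ (mem_iota1 kI); rewrite (negbTE np).
move=> /hasP[p pe /and5P[/eqP e1 /eqP e2 i1 i2 /andP[lt1 lt2]]]; exists p.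
by rewrite conc_kset ?e1 //; apply: (allP exact_pairs_exact).
Qed.

Lemma fact_exact k : 0 < k < 36 ->
  all (mem primes36) (fact k) /\ kprod (fact k) = kset k.
Proof.
elim: {k}(size (rep k)) {-2}k (leqnn (size (rep k))) => [|n IHn] k kn kI;
  have [kp|np] := boolP (k \in primes36).
- have := allP fact_check _ (mem_iota1 kI); rewrite kp => /eqP ->.
  by rewrite /kprod set_prod1 /= kp.
- have [p [_ _ _ _ [lt1 _]]] := exact_factor kI np.
  by have := leq_trans lt1 kn.
- have := allP fact_check _ (mem_iota1 kI); rewrite kp => /eqP ->.
  by rewrite /kprod set_prod1 /= kp.
- have [p [i1 i2 -> -> [lt1 lt2]]] := exact_factor kI np.
  have [a1 e1] := IHn _ (leq_trans lt1 kn) i1.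
  have [a2 e2] := IHn _ (leq_trans lt2 kn) i2.
  move: (fact p.1) (fact p.2) a1 a2 e1 e2 => f1 f2 a1 a2 e1 e2.
  split; first by rewrite all_cat a1 a2.
  by rewrite /kprod map_cat set_prod_cat; congr conc; [exact: e1|exact: e2].
Qed.

Lemma primes36_bounds k : k \in primes36 -> 0 < k < 36.
Proof.
have H : all (fun k => 0 < k < 36) primes36 by [].
exact: (allP H).
Qed.

Lemma primes36_neq0 ks : all (mem primes36) ks -> 0 \notin ks.
Proof. by move=> /allP H; apply/negP => /H. Qed.

(** [rep k] lies in the product, so [ks] is read off one of its compositions; [fact_uniq_check]
    refutes all of these but [fact k]. *)
Lemma fact_uniq k ks : 0 < k < 36 -> all (mem primes36) ks ->
  kprod ks = kset k -> ks = fact k.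
Proof.
move=> kI kp e; have ks0 := primes36_neq0 kp.
have /mapP[c cP ck] : ks \in [seq map run c | c <- comps (rep k)].
  by apply: kprodP => //; rewrite e /kset /= run_rep //; case/andP: kI.
have := allP (allP fact_uniq_check _ (mem_iota1 kI)) c cP.
by rewrite /= -ck kp; case: eqP => // _ /missedP/(_ ks0).
Qed.

(** Primality expressed through [M36] alone; the primes of both pairs are compared with it in
    [relprime_M] and [relprime_Lab]. *)
Definition Pab (s : M36) : Prop :=
  s <> 1%g /\
  forall s1 s2, s1 <> 1%g -> s2 <> 1%g -> Mab s <> conc (Mab s1) (Mab s2).

Lemma el_neq1 k : 0 < k < 36 -> el k <> 1%g.
Proof.
by move=> /andP[k0 lk] /h36_eq1 e; move: k0; rewrite -(run_rep lk) e.
Qed.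

Lemma Pab_el k : 0 < k < 36 -> (Pab (el k) <-> k \in primes36).
Proof.
move=> kI; split=> [[_ ek]|kp].
  have [//|np] := boolP (k \in primes36).
  have [[i j] /= [iI jI e _ _]] := exact_factor kI np.
  by case: (ek _ _ (el_neq1 iI) (el_neq1 jI)); rewrite !Mab_el.
split; first exact: el_neq1.
move=> _ _ /elP[i iI ->] /elP[j jI ->]; rewrite !Mab_el // => /esym e.
have ij0 : 0 \notin [:: i; j].
  rewrite !inE !(eq_sym 0) negb_or -!lt0n.
  by case/andP: iI => ->; case/andP: jI => ->.
have e2 : kprod [:: i; j] = kset k by rewrite /kprod /= conc1.
have /mapP[c cP ck] : [:: i; j] \in [seq map run c | c <- comps (rep k)].
  by apply: kprodP => //; rewrite e2 /kset /= run_rep //; case/andP: kI.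
have := allP (allP prime_check _ kp) c cP.
by rewrite /= -ck /= => /missedP/(_ ij0).
Qed.

Lemma Pab_seq (ps : seq M36) : {in ps, forall p, Pab p} ->
  exists2 ks, all (mem primes36) ks & ps = map el ks.
Proof.
elim: ps => [|p ps IHps] H; first by exists [::].
have [|ks kp ->] := IHps; first by move=> q qp; apply: H; rewrite inE qp orbT.
have Pp : Pab p by apply: H; rewrite mem_head.
have [k kI e] := elP Pp.1; exists (k :: ks); last by rewrite /= e.
by rewrite /= kp andbT; apply/Pab_el; rewrite // -e.
Qed.

Lemma map_Mab_el ks : all (mem primes36) ks ->
  [seq Mab p | p <- map el ks] = map kset ks.
Proof.
move=> /allP H; rewrite -map_comp; apply/eq_in_map => k /H kp.
by apply/Mab_el/primes36_bounds.
Qed.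

Lemma Mab_fact s : s <> 1%g -> exists ps, [/\ {in ps, forall p, Pab p},
  set_prod (map Mab ps) = Mab s &
  forall qs, {in qs, forall p, Pab p} ->
    set_prod (map Mab qs) = Mab s -> qs = ps].
Proof.
move=> /elP[k kI ->]; have [fp fk] := fact_exact kI.
exists (map el (fact k)); rewrite map_Mab_el // Mab_el //; split=> //.
  move=> _ /mapP[i /(allP fp) ip ->].
  by apply/(Pab_el (primes36_bounds ip)).
move=> _ /Pab_seq[ks kp ->]; rewrite map_Mab_el // => e.
by rewrite -(fact_uniq kI kp e).
Qed.

Lemma Pab_loop : exists p s, [/\ Pab p, s <> 1%g, ~ Pab s,
  (p * p = s)%g & (s * p = s)%g].
Proof.
(* [el 19] is the value of [baaa] and [el 35] that of its square; reading [baaa] from state 35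
   returns to 35. *)
exists (el 19), (el 35); split.
- by apply/Pab_el.
- exact: el_neq1.
- by move/(Pab_el (isT : 0 < 35 < 36)).
- by rewrite /el -wm_cat; apply/h36_run.
- by rewrite /el -wm_cat; apply/h36_run.
Qed.

(** * Contexts of the words [c^i u d^j] *)

(** With [c] below [a], [b] and these below [d], the words c^i u d^j are exactly the sorted ones;
    the common rank of [a] and [b] leaves [u] arbitrary. *)
Definition rank (x : Gamma) : nat :=
  match x with gc => 0 | ga | gb => 1 | gd => 2 end.
Definition rle : rel Gamma := fun x y => rank x <= rank y.
Definition is_ab : pred Gamma := fun x => rank x == 1.
Definition unemb (x : Gamma) : option ab :=
  match x with ga => Some la | gb => Some lb | _ => None end.

Definition word (i : nat) (u : seq ab) (j : nat) : seq Gamma :=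
  nseq i gc ++ map emb u ++ nseq j gd.

Lemma count_gc i u j : count_mem gc (word i u j) = i.
Proof.
rewrite !count_cat !count_nseq count_map mul1n mul0n.
by rewrite (eq_count (a2 := pred0)) ?count_pred0 ?addn0 //; case.
Qed.

Lemma count_gd i u j : count_mem gd (word i u j) = j.
Proof.
rewrite !count_cat !count_nseq count_map mul1n mul0n.
by rewrite (eq_count (a2 := pred0)) ?count_pred0 //; case.
Qed.

Lemma unemb_word i u j : pmap unemb (word i u j) = u.
Proof.
rewrite !pmap_cat (_ : pmap unemb (nseq i gc) = [::]); last by elim: i.
rewrite (_ : pmap unemb (nseq j gd) = [::]); last by elim: j.
by rewrite cats0 /=; elim: u => //= -[] u ->.
Qed.

Lemma word_inj i u j i' u' j' : word i u j = word i' u' j' ->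
  [/\ i = i', u = u' & j = j'].
Proof.
move=> e; split.
- by rewrite -(count_gc i u j) e count_gc.
- by rewrite -(unemb_word i u j) e unemb_word.
- by rewrite -(count_gd i u j) e count_gd.
Qed.

Lemma gc_word i u j : (gc \in word i u j) = (0 < i).
Proof. by rewrite -has_pred1 has_count count_gc. Qed.

Lemma gd_word i u j : (gd \in word i u j) = (0 < j).
Proof. by rewrite -has_pred1 has_count count_gd. Qed.

Lemma h36hat_word i u j : h36hat (word i u j) = h36 u.
Proof.
have hc n : h36hat (nseq n gc) = 1%g.
  elim: n => [|n IHn]; first exact: (wm_nil h36hat).
  rewrite -[nseq n.+1 _]/([:: gc] ++ nseq n gc).
  by rewrite wm_cat IHn mulg1 /= /free_fun big_seq1.
have hd n : h36hat (nseq n gd) = 1%g.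
  elim: n => [|n IHn]; first exact: (wm_nil h36hat).
  rewrite -[nseq n.+1 _]/([:: gd] ++ nseq n gd).
  by rewrite wm_cat IHn mulg1 /= /free_fun big_seq1.
by rewrite !wm_cat hc hd h36hat_emb mulg1 mul1g.
Qed.

Lemma hwrap_word i u j : hwrap (word i u j) = (h36 u, (0 < i, 0 < j)).
Proof. by rewrite -(h36hat_word i u j) -(gc_word i u j) -(gd_word i u j). Qed.

Lemma has_ab_word i u j : has is_ab (word i u j) = (u != [::]).
Proof.
rewrite !has_cat has_map !has_nseq !andbF orbF /=.
by case: u => // -[].
Qed.

Lemma word_sorted i u j : pairwise rle (word i u j).
Proof.
have all_const n x : pairwise rle (nseq n x).
  elim: n => //= n ->; rewrite andbT all_nseq; apply/orP; right.
  exact: leqnn.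
rewrite !pairwise_cat !all_const andbT /=; apply/and3P; split.
- apply/allrelP => x y /nseqP[-> _] _; exact: leq0n.
- apply/allrelP => x y /mapP[z _ ->] /nseqP[-> _]; by case: z.
- elim: u => //= x u ->; rewrite andbT; apply/allP => y /mapP[z _ ->].
  by case: x; case: z.
Qed.

Lemma sorted_word x : pairwise rle x -> exists i u j, x = word i u j.
Proof.
elim: x => [_|y x IHx /= /andP[yx /IHx[i [u [j e]]]]].
  by exists 0, [::], 0.
case: y yx => yx; last first.
- exists 0, [::], j.+1; rewrite e in yx *; have i0 : i = 0.
    by case: i yx {e} => //=.
  by move: yx; rewrite i0; case: u {e} => // -[].
- by exists i.+1, u, j; rewrite e.
- exists 0, (lb :: u), j; rewrite e in yx *.
  by case: i yx {e} => //=.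
- exists 0, (la :: u), j; rewrite e in yx *.
  by case: i yx {e} => //=.
Qed.

(** Each of the three conditions splits over concatenation into conditions on the pieces, which is
    how contexts are analysed. *)
Lemma LwrapE x : Lwrap x <-> [/\ pairwise rle x, count_mem gc x = count_mem gd x
                                & has is_ab x].
Proof.
split=> [[n [w [Lw ->]]]|[/sorted_word[i [u [j ->]]]]].
  rewrite -[Defs.wrap n w]/(word n w n) word_sorted count_gc count_gd
    has_ab_word.
  by split=> //; apply/eqP.
rewrite count_gc count_gd has_ab_word => -> /eqP u0.
by exists j, u.
Qed.

Lemma ctx_LwrapE x l r : ctx Lwrap x (l, r) <->
  [/\ [&& pairwise rle l, pairwise rle x, pairwise rle r, allrel rle l x,
          allrel rle l r & allrel rle x r],
      count_mem gc l + count_mem gc x + count_mem gc r =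
      count_mem gd l + count_mem gd x + count_mem gd r &
      [|| has is_ab l, has is_ab x | has is_ab r]].
Proof.
rewrite /ctx /= LwrapE !pairwise_cat allrel_catr !has_cat !count_cat !addnA.
set b := (X in [/\ X, _ & _] <-> _); set b' := (X in _ <-> [/\ X, _ & _]).
suff -> : b = b' by [].
rewrite /b /b'; case: (allrel rle l x); case: (allrel rle l r);
  case: (allrel rle x r); case: (pairwise rle l); case: (pairwise rle x) => //=;
  by rewrite ?andbF ?andbT.
Qed.

(* The factors of words of [Lwrap] are the words [word i u j] satisfying
   [factor i u j]. *)
Definition factor (i : nat) (u : seq ab) (j : nat) : Prop :=
  u = [::] -> i = 0 \/ j = 0.

Lemma ctx_factor x : ctx Lwrap x !=set0 ->
  exists i u j, x = word i u j /\ factor i u j.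
Proof.
move=> [[l r] /ctx_LwrapE[/and5P[_ xs _ lx /andP[_ xr]] _ H]].
have [i [u [j e]]] := sorted_word xs.
exists i, u, j; split=> // u0; move: H; rewrite e has_ab_word u0 /=.
(* The letter [a] or [b] must come from the context: on the left it excludes [c] from [x], on the
   right it excludes [d]. *)
case/orP=> /hasP[y yI y1]; [left|right]; apply/eqP; rewrite eqn0Ngt.
- rewrite -(gc_word i u j) -e; apply/negP => /(allrelP lx _ _ yI).
  by rewrite /rle (eqP y1).
- rewrite -(gd_word i u j) -e; apply/negP => /(fun h => allrelP xr _ _ h yI).
  by rewrite /rle (eqP y1).
Qed.

Lemma factor_ctx i u j : factor i u j -> ctx Lwrap (word i u j) !=set0.
Proof.
have [u0|u0 _] := eqVneq u [::].
  move=> /(_ u0)[] ->; rewrite {}u0.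
    (* A power of [d] or of [c] is completed by one [a] and the matching power of the other
       letter. *)
    exists (nseq j gc ++ [:: ga], [::]), j, [:: la]; split=> //=.
    by rewrite cats0 -catA.
  exists ([::], ga :: nseq i gd), i, [:: la]; split=> //=.
  by rewrite /word cats0.
(* Adding [j] letters [c] and [i] letters [d] balances both counts at [i + j]. *)
exists (nseq j gc, nseq i gd), (i + j), u; split; first exact/eqP.
by rewrite /= /Defs.wrap /word -!catA -nseqD catA -nseqD (addnC i j).
Qed.

Lemma wrapE n u : Defs.wrap n u = word n u n. Proof. by []. Qed.

Lemma cat_word_c n i u j : nseq n gc ++ word i u j = word (n + i) u j.
Proof. by rewrite /word nseqD catA. Qed.

Lemma cat_word_d n i u j : word i u j ++ nseq n gd = word i u (j + n).
Proof. by rewrite /word nseqD -!catA. Qed.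

Lemma word_nil : word 0 [::] 0 = [::]. Proof. by []. Qed.

Lemma word_c n : word n [::] 0 = nseq n gc.
Proof. by rewrite /word /= cats0. Qed.

Lemma word_d n : word 0 [::] n = nseq n gd. Proof. by []. Qed.

Lemma word_u u : word 0 u 0 = map emb u.
Proof. by rewrite /word /= cats0. Qed.

Lemma nil_h36 u u' : h36 u = h36 u' -> (u == [::]) = (u' == [::]).
Proof.
by move=> e; apply/eqP/eqP => u0; apply: h36_eq1; [rewrite -e|rewrite e];
  rewrite u0 wm_nil.
Qed.

(** The order conditions against a context depend only on the ranks that occur, so words with the
    same kinds of letters are interchangeable there. *)
Lemma word_ranks i u j i' u' j' : (0 < i) = (0 < i') -> (0 < j) = (0 < j') ->
  (u == [::]) = (u' == [::]) ->
  {in word i u j, forall y, exists2 y', y' \in word i' u' j' & rank y' = rank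
    y}.
Proof.
move=> ei ej eu y yw.
have ab : rank y = 1 ->
    exists2 y', y' \in word i' u' j' & rank y' = rank y.
  move=> y1; have : has is_ab (word i' u' j').
    by rewrite has_ab_word -eu -(has_ab_word i u j); apply/hasP; exists y;
      rewrite // /is_ab y1.
  by case/hasP=> y' y'w /eqP e; exists y' => //; rewrite e y1.
case: y yw ab => yw ab; try exact: ab.
  by exists gc; rewrite // gc_word -ei -(gc_word i u j).
by exists gd; rewrite // gd_word -ej -(gd_word i u j).
Qed.

(** The first hypothesis is i - j = i' - j' without subtraction and preserves the count condition;
    the others preserve the order conditions through [word_ranks]. *)
Lemma sub_ctx_word i u j i' u' j' : i + j' = i' + j ->
  (0 < i) = (0 < i') -> (0 < j) = (0 < j') -> (u == [::]) = (u' == [::]) ->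
  ctx Lwrap (word i u j) `<=` ctx Lwrap (word i' u' j').
Proof.
move=> e ei ej eu [l r] /ctx_LwrapE.
rewrite !count_gc !count_gd has_ab_word eu => -[].
move=> /and5P[pl _ pr lw /andP[lr wr]] ec hab.
have ranks := word_ranks (esym ei) (esym ej) (esym eu).
apply/ctx_LwrapE; rewrite !count_gc !count_gd has_ab_word; split=> //;
  last first.
  by move: ec; move: (count _ l) (count _ r) (count _ l) (count _ r); lia.
rewrite pl pr lr word_sorted /=; apply/andP; split.
  apply/allrelP => x y xl /ranks[y' y'w ry].
  by have := allrelP lw _ _ xl y'w; rewrite /rle ry.
apply/allrelP => x y /ranks[x' x'w rx] yr.
by have := allrelP wr _ _ x'w yr; rewrite /rle rx.
Qed.

Lemma syn_word i u j i' u' j' : i + j' = i' + j ->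
  (0 < i) = (0 < i') -> (0 < j) = (0 < j') -> (u == [::]) = (u' == [::]) ->
  syn_equiv Lwrap (word i u j) (word i' u' j').
Proof.
move=> e ei ej eu; apply/seteqP; split; apply: sub_ctx_word => //.
Qed.

Lemma ctx_count i u j i' u' j' :
  ctx Lwrap (word i u j) `&` ctx Lwrap (word i' u' j') !=set0 ->
  i + j' = i' + j.
Proof.
move=> [[l r] [/ctx_LwrapE[_ + _] /ctx_LwrapE[_ + _]]].
rewrite !count_gc !count_gd.
move: (count_mem gc l) (count_mem gc r) (count_mem gd l) (count_mem gd r).
move=> a b c d; lia.
Qed.

(** [factor] provides a context, and a single common context already fixes the difference i - j. *)
Lemma theta_word i u j i' u' j' : factor i u j ->
  (theta Lwrap hwrap (word i u j) (word i' u' j') <->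
   [/\ h36 u = h36 u', i + j' = i' + j, (0 < i) = (0 < i') & (0 < j) = (0 <
     j')]).
Proof.
move=> f; split=> [[es]|[eu e ei ej]].
  rewrite !hwrap_word => -[eu ei ej]; split=> //.
  apply: (@ctx_count i u j i' u' j').
  by rewrite -es setIid; exact: factor_ctx.
split; first by apply: syn_word => //; exact: nil_h36.
by rewrite !hwrap_word eu ei ej.
Qed.

(** A common context fixes i - j and [hwrap] fixes the kinds of letters that occur; together these
    determine the context set. *)
Lemma substitutable_Lwrap : substitutable Lwrap hwrap.
Proof.
move=> x y; have [[c cI]|e] := pselect (ctx Lwrap x `&` ctx Lwrap y !=set0);
  last by [].
have [i [u [j [-> _]]]] := ctx_factor (ex_intro _ c cI.1).
have [i' [u' [j' [-> _]]]] := ctx_factor (ex_intro _ c cI.2).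
rewrite !hwrap_word => -[/nil_h36 eu ei ej] /ctx_count e.
exact: syn_word.
Qed.

Lemma cl_word i u j : factor i u j -> cl Lwrap hwrap (word i u j) =
  [set x | exists i' u' j', x = word i' u' j' /\
     [/\ h36 u = h36 u', i + j' = i' + j, (0 < i) = (0 < i') & (0 < j) = (0 <
       j')]].
Proof.
move=> f; apply/seteqP; split=> [x xw|_ [i' [u' [j' [-> H]]]]]; last first.
  exact/theta_word.
have [|i' [u' [j' [e _]]]] := @ctx_factor x.
  by rewrite -xw.1; exact: factor_ctx.
by exists i', u', j'; split=> //; apply/(theta_word _ _ _ f); rewrite -e.
Qed.

Lemma relclass_cl (S : finType) (M : monoidType) (L : set (seq S))
  (h : wordmorph S M) X x : relclass L h X -> X x -> X = cl L h x.
Proof.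
move=> [y _ <-] [e1 h1]; apply/seteqP; split=> z [e2 h2]; split.
- exact: etrans (esym e1) e2.
- exact: etrans (esym h1) h2.
- exact: etrans e1 e2.
- exact: etrans h1 h2.
Qed.

Lemma cl_nil : unitcl Lwrap hwrap = [set [::]].
Proof.
have f : factor 0 [::] 0 by left.
rewrite /unitcl -word_nil cl_word //; apply/seteqP; split.
  move=> _ [i [u [j [-> [+ _]]]]]; rewrite wm_nil => /esym/h36_eq1 ->.
  by case: i => //; case: j => // _ _; rewrite word_nil.
by move=> _ ->; exists 0, [::], 0; rewrite word_nil.
Qed.

(** * Live relative classes *)

#[local] Arguments word : simpl never.

Lemma emb_inj : injective emb. Proof. by case; case. Qed.

Lemma map_emb_inj : injective (map emb). Proof. exact/inj_map/emb_inj. Qed.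

Lemma embcl_inj : injective embcl.
Proof.
move=> X Y e; apply/seteqP; split=> u Xu.
  have : embcl X (map emb u) by exists u.
  by rewrite e => -[v Yv /map_emb_inj <-].
have : embcl Y (map emb u) by exists u.
by rewrite -e => -[v Yv /map_emb_inj <-].
Qed.

Lemma embcl_conc X Y : embcl (conc X Y) = conc (embcl X) (embcl Y).
Proof.
apply/seteqP; split=> [_ [_ [u Xu [v Yv <-]] <-]|].
  by rewrite map_cat; exists (map emb u); [exists u | exists (map emb v);
    [exists v|]].
move=> _ [_ [u Xu <-] [_ [v Yv <-] <-]]; rewrite -map_cat.
by exists (u ++ v) => //; exists u => //; exists v.
Qed.

Lemma embcl_nil : embcl [set [::]] = [set [::]].
Proof. by rewrite /embcl image_set1. Qed.

Lemma embcl_set_prod s : embcl (set_prod s) = set_prod (map embcl s).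
Proof. by elim: s => [|X s IHs] /=; rewrite ?embcl_nil // embcl_conc IHs. Qed.

Lemma Mab_neq0 s : s <> 1%g -> exists2 u, u <> [::] & h36 u = s.
Proof.
have [u us] := h36_surj s; move=> s1; exists u => // u0.
by apply: s1; rewrite -us u0 wm_nil.
Qed.

Lemma h36_neq1 u : u <> [::] -> h36 u <> 1%g.
Proof. by move=> u0 /h36_eq1. Qed.

Lemma Mcl_word s x : Mcl s x <-> exists2 u, x = word 0 u 0 & Mab s u.
Proof.
split=> [[u Mu <-]|[u -> Mu]]; exists u => //; by rewrite word_u.
Qed.

Lemma Wcl_word s x :
  Wcl s x <-> exists n u, [/\ 1 <= n, x = word n u n & Mab s u].
Proof.
split=> [[n [u [n1 Mu ->]]]|[n [u [n1 -> Mu]]]]; exists n, u; split=> //.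
Qed.

Definition box (i : nat) (Y : set (seq Gamma)) (j : nat) : set (seq Gamma) :=
  conc [set nseq i gc] (conc Y [set nseq j gd]).

Lemma boxE i Y j x :
  box i Y j x <-> exists2 y, Y y & x = nseq i gc ++ y ++ nseq j gd.
Proof.
split=> [[_ -> [_ [y Yy [_ -> <-]] <-]]|[y Yy ->]]; first by exists y.
by exists (nseq i gc) => //; exists (y ++ nseq j gd) => //; exists y => //;
  exists (nseq j gd).
Qed.

Lemma cat_word i j k l u :
  nseq i gc ++ word k u l ++ nseq j gd = word (i + k) u (l + j).
Proof. by rewrite cat_word_d cat_word_c. Qed.

Definition core (Y : set (seq Gamma)) : Prop :=
  Y = [set [::]] \/ exists2 s, s <> 1%g & Y = Mcl s \/ Y = Wcl s.

(** As one of [i], [j] is 0, the difference i - j and the positivity flags recover both, up to the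
    balanced layers that [Wcl] absorbs. *)
Lemma box_cl i Y j : core Y -> i = 0 \/ j = 0 ->
  exists i' u j', factor i' u j' /\ box i Y j = cl Lwrap hwrap (word i' u j').
Proof.
move=> [->|[s s1 []->]] ij.
- have f : factor i [::] j by move=> _.
  exists i, [::], j; split=> //; rewrite cl_word //; apply/seteqP; split.
    move=> x /boxE[_ -> ->]; exists i, [::], j.
    by rewrite -word_nil cat_word add0n addn0.
  move=> _ [i' [u [j' [-> [+ e ei ej]]]]]; rewrite wm_nil => /esym/h36_eq1 ->.
  apply/boxE; exists [::] => //; rewrite -word_nil cat_word.
  by congr word; move: ij e ei ej; lia.
- have [u u0 us] := Mab_neq0 s1.
  have f : factor i u j by [].
  exists i, u, j; split=> //; rewrite cl_word //; apply/seteqP; split.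
    move=> x /boxE[_ /Mcl_word[v -> [_ vs]] ->]; exists i, v, j.
    by rewrite cat_word addn0 add0n us vs.
  move=> _ [i' [v [j' [-> [+ e ei ej]]]]] => uv.
  apply/boxE; exists (word 0 v 0); last first.
    by rewrite cat_word; congr word; move: ij e ei ej; lia.
  apply/Mcl_word; exists v => //; split; last by rewrite -uv.
  by move=> v0; apply: u0; apply/eqP; rewrite (nil_h36 uv) v0.
- have [u u0 us] := Mab_neq0 s1.
  have f : factor i.+1 u j.+1 by [].
  (* The extra [c] and [d] are the one layer that [Wcl] requires. *)
  exists i.+1, u, j.+1; split=> //; rewrite cl_word //; apply/seteqP; split.
    move=> x /boxE[_ /Wcl_word[n [v [n1 -> [_ vs]]]] ->].
    exists (i + n), v, (n + j).
    by rewrite cat_word us vs; split=> //; split=> //; lia.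
  move=> _ [i' [v [j' [-> [+ e ei ej]]]]] => uv.
  apply/boxE; exists (word (i' - i) v (i' - i)); last first.
    by rewrite cat_word; congr word; move: ij e ei ej; lia.
  apply/Wcl_word; exists (i' - i), v; split=> //; first by move: ij e ei ej;
    lia.
  split; last by rewrite -uv.
  by move=> v0; apply: u0; apply/eqP; rewrite (nil_h36 uv) v0.
Qed.

Lemma live_cl i u j : factor i u j -> live Lwrap (cl Lwrap hwrap (word i u j)).
Proof. by move=> f x [<- _]; exact: factor_ctx. Qed.

Lemma box_relclass i Y j : core Y -> i = 0 \/ j = 0 ->
  relclass Lwrap hwrap (box i Y j) /\ live Lwrap (box i Y j).
Proof.
move=> cY ij; have [i' [u [j' [f ->]]]] := box_cl cY ij.
by split; [eexists | exact: live_cl].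
Qed.

Lemma relclass_eq (S : finType) (M : monoidType) (L : set (seq S))
  (h : wordmorph S M) X Y x :
  relclass L h X -> relclass L h Y -> X x -> Y x -> X = Y.
Proof. by move=> rX rY /(relclass_cl rX) -> /(relclass_cl rY) ->. Qed.

Lemma relclass_neq0 (S : finType) (M : monoidType) (L : set (seq S))
  (h : wordmorph S M) X : relclass L h X -> exists x, X x.
Proof. by move=> [x _ <-]; exists x; exact: theta_refl. Qed.

Lemma word_box i u j : factor i u j ->
  exists k Y l, [/\ core Y, k = 0 \/ l = 0 & box k Y l (word i u j)].
Proof.
move=> f; have [u0|/eqP u0] := eqVneq u [::].
  exists i, [set [::]], j; split; [by left|exact: f|].
  by apply/boxE; exists [::] => //; rewrite u0 -word_nil cat_word addn0.
have u1 : h36 u <> 1%g by exact: h36_neq1.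
have [ij|ij] := pselect (i = 0 \/ j = 0).
  exists i, (Mcl (h36 u)), j; split=> //; first by right; exists (h36 u);
    [|left].
  apply/boxE; exists (word 0 u 0); last by rewrite cat_word addn0.
  by apply/Mcl_word; exists u.
(* The core takes [minn i j] layers; truncated subtraction leaves the excess on one side only. *)
exists (i - j), (Wcl (h36 u)), (j - i); split=> //; [|lia|].
  by right; exists (h36 u); [|right].
apply/boxE; exists (word (minn i j) u (minn i j)).
  by apply/Wcl_word; exists (minn i j), u; split=> //; lia.
by rewrite cat_word; congr word; lia.
Qed.

Lemma live_box X : relclass Lwrap hwrap X -> live Lwrap X ->
  exists i Y j, [/\ core Y, i = 0 \/ j = 0 & X = box i Y j].
Proof.
move=> rX lX; have [x Xx] := relclass_neq0 rX.
have [i [u [j [e f]]]] := ctx_factor (lX x Xx).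
have [k [Y [l [cY kl Bx]]]] := word_box f; exists k, Y, l; split=> //.
apply: (relclass_eq rX _ Xx); last by rewrite e.
by have [] := box_relclass cY kl.
Qed.

Lemma box0 Y : box 0 Y 0 = Y.
Proof. by rewrite /box conc1l conc1. Qed.

(** * Relative primes *)

Lemma boxS i Y j : box i.+1 Y j = conc Ccl (box i Y j).
Proof.
rewrite /box [RHS]concA; congr conc; apply/seteqP;
  split=> [_ ->|_ [_ -> [_ -> <-]]] //.
by exists [:: gc] => //; exists (nseq i gc).
Qed.

Lemma box_rcons i Y j : box i Y j.+1 = conc (box i Y j) Dcl.
Proof.
rewrite /box -!concA; congr conc; congr conc.
apply/seteqP; split=> [_ ->|_ [_ -> [_ -> <-]]].
  by exists (nseq j gd) => //; exists [:: gd] => //; rewrite -addn1 nseqD.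
by rewrite -[[:: gd]]/(nseq 1 gd) -nseqD addn1.
Qed.

Lemma core_nil : core [set [::]]. Proof. by left. Qed.

Lemma core_M s : s <> 1%g -> core (Mcl s).
Proof. by right; exists s; [|left]. Qed.

Lemma core_W s : s <> 1%g -> core (Wcl s).
Proof. by right; exists s; [|right]. Qed.

Lemma Ccl_box : Ccl = box 1 [set [::]] 0.
Proof. by rewrite boxS box0 conc1. Qed.

Lemma Dcl_box : Dcl = box 0 [set [::]] 1.
Proof. by rewrite box_rcons box0 conc1l. Qed.

Lemma Ccl_relclass : relclass Lwrap hwrap Ccl /\ live Lwrap Ccl.
Proof. by rewrite Ccl_box; apply: box_relclass; [exact: core_nil|right]. Qed.

Lemma Dcl_relclass : relclass Lwrap hwrap Dcl /\ live Lwrap Dcl.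
Proof. by rewrite Dcl_box; apply: box_relclass; [exact: core_nil|left]. Qed.

Lemma Mcl_relclass s : s <> 1%g ->
  relclass Lwrap hwrap (Mcl s) /\ live Lwrap (Mcl s).
Proof.
by move=> s1; rewrite -[Mcl s]box0; apply: box_relclass; [exact: core_M|left].
Qed.

Lemma Wcl_relclass s : s <> 1%g ->
  relclass Lwrap hwrap (Wcl s) /\ live Lwrap (Wcl s).
Proof.
by move=> s1; rewrite -[Wcl s]box0; apply: box_relclass; [exact: core_W|left].
Qed.

Lemma unit_of_nil X : relclass Lwrap hwrap X -> X [::] ->
  X = unitcl Lwrap hwrap.
Proof. by move=> rX /(relclass_cl rX). Qed.

(** Testing one member [x] suffices: a factorization of [P] cuts [x], and a relative class
    containing the empty word is the unit class. *)
Lemma relprimeI P x : relclass Lwrap hwrap P -> live Lwrap P -> ~ P [::] ->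
  P x ->
  (forall X Y y z, relclass Lwrap hwrap X -> relclass Lwrap hwrap Y ->
     P = conc X Y -> x = y ++ z -> X y -> Y z -> y = [::] \/ z = [::]) ->
  relprime Lwrap hwrap P.
Proof.
move=> rP lP P0 Px H; split=> //; first by rewrite cl_nil => e; apply: P0;
  rewrite e.
move=> X Y rX rY e; move: (Px); rewrite e => -[y Xy [z Yz exyz]].
have [y0|z0] := H X Y y z rX rY e (esym exyz) Xy Yz; [left|right].
  by apply: unit_of_nil; rewrite -?y0.
by apply: unit_of_nil; rewrite -?z0.
Qed.

Lemma relprime_C : relprime Lwrap hwrap Ccl.
Proof.
have [rC lC] := Ccl_relclass.
apply: (relprimeI rC lC _ (erefl : Ccl [:: gc])) =>
  // X Y [|a [|b y]] [|c z] //=;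
  by [left|right].
Qed.

Lemma relprime_D : relprime Lwrap hwrap Dcl.
Proof.
have [rD lD] := Dcl_relclass.
apply: (relprimeI rD lD _ (erefl : Dcl [:: gd])) =>
  // X Y [|a [|b y]] [|c z] //=;
  by [left|right].
Qed.

Lemma theta_count x y : theta Lwrap hwrap x y -> ctx Lwrap x !=set0 ->
  count_mem gc x + count_mem gd y = count_mem gc y + count_mem gd x.
Proof.
move=> [e _] nx; have ny := nx; rewrite e in ny.
have [i [u [j [ex _]]]] := ctx_factor nx.
have [i' [u' [j' [ey _]]]] := ctx_factor ny.
rewrite ex ey !count_gc !count_gd; apply: (@ctx_count i u j i' u' j').
by rewrite -ex -ey e setIid -e.
Qed.

Lemma ctx_infix x y z : ctx Lwrap (x ++ y ++ z) !=set0 -> ctx Lwrap y !=set0.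
Proof.
move=> [[l r]]; rewrite /ctx /= => H; exists (l ++ x, z ++ r).
by rewrite /= -!catA in H *.
Qed.

(** If c u d = x y with both parts nonempty, then x has no [d] and y has no [c]. Cutting c^2 u d^2
    by the same classes gives parts with the same absences, hence equally many [c] in the left part,
    although the totals are 1 and 2. *)
Lemma relprime_W s : s <> 1%g -> relprime Lwrap hwrap (Wcl s).
Proof.
move=> s1; have [rW lW] := Wcl_relclass s1; have [u u0 us] := Mab_neq0 s1.
have Wn n : 0 < n -> Wcl s (word n u n).
  by move=> n0; apply/Wcl_word; exists n, u.
apply: (relprimeI rW lW _ (Wn 1 isT)).
  by move=> /Wcl_word[n [v [n1 e _]]]; have := count_gc n v n; rewrite -e => n0;
    rewrite -n0 in n1.
move=> X Y x y rX rY e exy Xx Yy.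
case: (eqVneq x [::]) => [|x0]; [by left|].
case: (eqVneq y [::]) => [|y0]; [by right|].
have := Wn 2 isT; rewrite {1}e => -[x2 Xx2 [y2 Yy2 exy2]].
have lxy : ctx Lwrap (x ++ y) !=set0 by apply: lW; rewrite -exy; exact: Wn.
have lx : ctx Lwrap x !=set0 by apply: (@ctx_infix [::] x y).
have ly : ctx Lwrap y !=set0 by apply: (@ctx_infix x y [::]); rewrite cats0.
have tx : theta Lwrap hwrap x x2 by rewrite (relclass_cl rX Xx) in Xx2.
have ty : theta Lwrap hwrap y y2 by rewrite (relclass_cl rY Yy) in Yy2.
have dx : count_mem gd x = 0.
  case/lastP: (y) y0 exy => // y' c _.
  rewrite -rcons_cat (_ : word 1 u 1 = rcons (word 1 u 0) gd); last first.
    by rewrite -cats1 -[[:: gd]]/(nseq 1 gd) cat_word_d.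
  move=> /rcons_inj[exy' _]; have := count_gd 1 u 0.
  by rewrite exy' count_cat; lia.
have cy : count_mem gc y = 0.
  case: (x) x0 exy => // c x' _.
  rewrite (_ : word 1 u 1 = gc :: word 0 u 1) // => -[_ exy'].
  by have := count_gc 0 u 1; rewrite exy' count_cat; lia.
(* The [chi] component transfers the absence of [c] or [d] between [theta]-related words. *)
have ch v w : theta Lwrap hwrap v w -> forall c, c \in [:: gc; gd] ->
    count_mem c v = 0 -> count_mem c w = 0.
  move=> [_ /(congr1 snd)[e1 e2]] c.
  have hc : (c \in v) = (c \in w) -> count_mem c v = 0 -> count_mem c w = 0.
    rewrite -!has_pred1 !has_count => evw cv; apply/eqP.
    by rewrite eqn0Ngt -evw cv.
  by rewrite !inE => /orP[] /eqP ec; rewrite ec in hc *; apply: hc.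
have dx2 := ch _ _ tx gd isT dx; have cy2 := ch _ _ ty gc isT cy.
have := theta_count tx lx; rewrite dx dx2.
move: (congr1 (count_mem gc) exy) (congr1 (count_mem gc) exy2).
by rewrite !count_gc !count_cat cy cy2; lia.
Qed.

(** A positive exponent splits off [Ccl] or [Dcl] exactly, so a prime is one of these or a bare
    nonunit core. *)
Lemma relprime_cases P : relprime Lwrap hwrap P ->
  [\/ P = Ccl, P = Dcl, exists2 s, s <> 1%g & P = Mcl s |
      exists2 s, s <> 1%g & P = Wcl s].
Proof.
move=> [rP lP nu dec]; have [i [Y [j [cY ij eP]]]] := live_box rP lP.
case: i ij eP => [|i] ij eP.
  case: j ij eP => [|j] ij eP.
    rewrite box0 in eP; case: cY => [e0|[s s1 [] e]].
    - by case: nu; rewrite cl_nil eP e0.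
    - by constructor 3; exists s; rewrite // eP.
    - by constructor 4; exists s; rewrite // eP.
  rewrite box_rcons in eP; constructor 2.
  have [rb _] : relclass Lwrap hwrap (box 0 Y j) /\ live Lwrap (box 0 Y j).
    by apply: box_relclass => //; left.
  case: (dec _ _ rb Dcl_relclass.1 eP) => e.
    by rewrite eP e cl_nil conc1l.
  have : Dcl [::] by rewrite e cl_nil.
  by [].
have j0 : j = 0 by case: ij.
rewrite boxS in eP; constructor 1.
have [rb _] : relclass Lwrap hwrap (box i Y j) /\ live Lwrap (box i Y j).
  by apply: box_relclass => //; right.
case: (dec _ _ Ccl_relclass.1 rb eP) => e.
  have : Ccl [::] by rewrite e cl_nil.
  by [].
by rewrite eP e cl_nil conc1.
Qed.

Lemma Mcl_nil s : ~ Mcl s [::].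
Proof. by move=> [[|x u] [u0 _]]. Qed.

Lemma relprime_M s : s <> 1%g -> (relprime Lwrap hwrap (Mcl s) <-> Pab s).
Proof.
move=> s1; have [rM lM] := Mcl_relclass s1; split=> [[_ _ _ dec]|[_ dec]].
  split=> // s2 s3 s21 s31 e.
  have eM : Mcl s = conc (Mcl s2) (Mcl s3) by rewrite /Mcl -embcl_conc -e.
  have nM t : Mcl t <> unitcl Lwrap hwrap.
    by move=> et; apply: (@Mcl_nil t); rewrite et cl_nil.
  by case: (dec _ _ (Mcl_relclass s21).1 (Mcl_relclass s31).1 eM) => /nM.
have [u u0 us] := Mab_neq0 s1.
have Mu : Mcl s (map emb u) by exists u.
apply: (relprimeI rM lM (@Mcl_nil s) Mu) => X Y x y rX rY e exy Xx Yy.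
have [|x0] := eqVneq x [::]; [by left|].
have [|y0] := eqVneq y [::]; [by right|].
(* A cut of an embedded word comes from a cut of [u], so both factors are classes [Mcl]. *)
have [v [w [ev ew]]] : exists v w, x = map emb v /\ y = map emb w.
  exists (take (size x) u), (drop (size x) u).
  by rewrite map_take map_drop exy take_size_cat // drop_size_cat.
have v0 : v <> [::] by move=> v0; rewrite ev v0 in x0.
have w0 : w <> [::] by move=> w0; rewrite ew w0 in y0.
have eX : X = Mcl (h36 v).
  by apply: (relclass_eq rX (Mcl_relclass (h36_neq1 v0)).1 Xx); exists v.
have eY : Y = Mcl (h36 w).
  by apply: (relclass_eq rY (Mcl_relclass (h36_neq1 w0)).1 Yy); exists w.
case: (dec _ _ (h36_neq1 v0) (h36_neq1 w0)).
by apply: embcl_inj; rewrite embcl_conc -[embcl _]/(Mcl s) e eX eY.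
Qed.

Lemma P36_Pab s : P36 s <-> Pab s.
Proof.
split=> [[s1 /(relprime_M s1)] //|Ps].
by split; [exact: Ps.1|apply/(relprime_M Ps.1)].
Qed.

Lemma relprime_Lwrap : relprime Lwrap hwrap =
    [set Ccl; Dcl] `|` Mcl @` P36 `|` Wcl @` [set s | s <> 1%g].
Proof.
apply/seteqP; split=> [P pP|P].
  have [->|->|[s s1 e]|[s s1 ->]] := relprime_cases pP.
  - by left; left; left.
  - by left; left; right.
  - by left; right; exists s; rewrite // /P36 /= -e.
  - by right; exists s.
case=> [[[]->|[s [_ pM] <-]]|[s s1 <-]] //.
- exact: relprime_C.
- exact: relprime_D.
- exact: relprime_W.
Qed.

(** * Relative classes and primes of the pair [Lab], [h36] *)

Lemma ctx_Lab x y : x <> [::] -> y <> [::] -> ctx Lab x = ctx Lab y.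
Proof.
move=> x0 y0; apply/seteqP; split=> -[l r] _; rewrite /ctx /Lab /=;
  case: l => //= e; [apply: y0; case: (y) e|apply: x0; case: (x) e]; by [].
Qed.

(** Nonempty words all have the same contexts in [Lab], so their relative classes are the fibres of
    [h36]. *)
Lemma cl_Lab u : u <> [::] -> cl Lab h36 u = Mab (h36 u).
Proof.
move=> u0; apply/seteqP; split=> v [e1 e2].
  by split=> // v0; apply: u0; apply: h36_eq1; rewrite e2 v0 wm_nil.
by split=> //; exact: ctx_Lab.
Qed.

Lemma cl_Lab_nil : unitcl Lab h36 = [set [::]].
Proof.
apply/seteqP; split=> [u [_]|_ -> //].
by rewrite wm_nil => /esym/h36_eq1.
Qed.

Lemma relclass_Mab s : s <> 1%g -> relclass Lab h36 (Mab s).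
Proof.
by move=> /Mab_neq0[u u0 <-]; exists u => //; rewrite cl_Lab.
Qed.

Lemma relclass_Lab X : relclass Lab h36 X ->
  X = unitcl Lab h36 \/ exists2 s, s <> 1%g & X = Mab s.
Proof.
move=> [u _ <-]; have [->|/eqP u0] := eqVneq u [::]; [by left|right].
by exists (h36 u); [exact: h36_neq1|rewrite cl_Lab].
Qed.

Lemma relprime_Lab X :
  relprime Lab h36 X <-> exists2 s, Pab s & X = Mab s.
Proof.
split=> [[rX lX nu dec]|[s [s1 dec] ->]].
  have [|[s s1 e]] := relclass_Lab rX; [by []|].
  exists s => //; split=> // s2 s3 s21 s31; rewrite -e => es.
  have nM t : Mab t <> unitcl Lab h36.
    rewrite cl_Lab_nil => et; have [] : Mab t [::] by rewrite et.
    by [].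
  by case: (dec _ _ (relclass_Mab s21) (relclass_Mab s31) es) => /nM.
split.
- exact: relclass_Mab.
- move=> u [u0 _]; exists ([::], [::]) => /=; rewrite /ctx /= cats0; exact: u0.
- rewrite cl_Lab_nil => et; have [] : Mab s [::] by rewrite et.
  by [].
- move=> X1 X2 /relclass_Lab[->|[s2 s21 ->]]; first by left.
  move=> /relclass_Lab[->|[s3 s31 ->]]; first by right.
  by move=> e; case: (dec _ _ s21 s31).
Qed.

(** * Exact factorizations *)

(** [seqM] and [seqW] are the two shapes a sequence of primes can have when its product contains a
    live word. *)
Definition seqM (i : nat) (ps : seq M36) (j : nat) : seq (set (seq Gamma)) :=
  nseq i Ccl ++ map Mcl ps ++ nseq j Dcl.
Definition seqW (i : nat) (s : M36) (j : nat) : seq (set (seq Gamma)) :=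
  nseq i Ccl ++ Wcl s :: nseq j Dcl.

Lemma set_prod_nseq (T : finType) (x : T) n :
  set_prod (nseq n [set [:: x]]) = [set nseq n x].
Proof.
elim: n => //= n ->; apply/seteqP; split=> [_ [_ -> [_ -> <-]] //|_ ->].
by exists [:: x] => //; exists (nseq n x).
Qed.

Lemma set_prod_seqM i ps j :
  set_prod (seqM i ps j) = box i (embcl (set_prod (map Mab ps))) j.
Proof.
rewrite !set_prod_cat !set_prod_nseq; congr conc; congr conc.
by rewrite embcl_set_prod -map_comp.
Qed.

Lemma set_prod_seqMP i ps j z : set_prod (seqM i ps j) z <->
  exists2 u, z = word i u j & set_prod (map Mab ps) u.
Proof.
rewrite set_prod_seqM; split=> [/boxE[_ [u pu <-] ->]|[u -> pu]].
  by exists u; rewrite // -word_u cat_word addn0.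
apply/boxE; exists (map emb u); first by exists u.
by rewrite -word_u cat_word addn0.
Qed.

Lemma set_prod_seqW i s j : set_prod (seqW i s j) = box i (Wcl s) j.
Proof.
by rewrite set_prod_cat -cat1s set_prod_cat !set_prod_nseq set_prod1.
Qed.

Lemma box_Wcl i s j z : box i (Wcl s) j z <->
  exists n u, [/\ 0 < n, Mab s u & z = word (i + n) u (j + n)].
Proof.
split=> [/boxE[_ /Wcl_word[n [u [n0 -> su]] ->]]|[n [u [n0 su ->]]]].
  by exists n, u; rewrite cat_word (addnC n).
apply/boxE; exists (word n u n); last by rewrite cat_word (addnC n).
by apply/Wcl_word; exists n, u.
Qed.

Lemma set_prod_Mab ps u : set_prod (map Mab ps) u ->
  h36 u = (\prod_(p <- ps) p)%g /\ (u == [::]) = (ps == [::]).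
Proof.
elim: ps u => [_ ->|p ps IHps _ [v [v0 vp] [w /IHps[wp _] <-]]].
  by rewrite big_nil wm_nil.
rewrite big_cons wm_cat vp wp; split=> //.
by case: (v) v0.
Qed.

Lemma live_after_ab x y : ctx Lwrap (x ++ y) !=set0 -> has is_ab x ->
  gc \notin y.
Proof.
move=> /ctx_factor[i [u [j [e _]]]] /hasP[a ax aab]; apply/negP => cy.
have := word_sorted i u j;
  rewrite -e pairwise_cat => /andP[/allrelP/(_ a gc ax cy)].
by rewrite /rle (eqP aab).
Qed.

Lemma live_after_d x y : ctx Lwrap (x ++ y) !=set0 -> gd \in x ->
  gc \notin y /\ ~~ has is_ab y.
Proof.
move=> /ctx_factor[i [u [j [e _]]]] dx.
have := word_sorted i u j; rewrite -e pairwise_cat => /andP[/allrelP H _].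
split; first by apply/negP => /(H _ _ dx).
by apply/hasPn => a /(H _ _ dx); rewrite /is_ab; case: a.
Qed.

Lemma live_word i u j : ctx Lwrap (word i u j) !=set0 -> factor i u j.
Proof. by move=> /ctx_factor[i' [u' [j' [/word_inj[-> -> ->]]]]]. Qed.

Lemma star_cons (T : eqType) (A : set T) x s : star A (x :: s) ->
  A x /\ star A s.
Proof.
move=> H; split; first by apply: H; rewrite mem_head.
by move=> y ys; apply: H; rewrite inE ys orbT.
Qed.

(** Induction from the left. In a live word no [c] follows [a] or [b], and only [d] follows [d]; so
    after [Mcl] come only [Mcl] and [Dcl], and after [Wcl] or [Dcl] only [Dcl]. *)
Lemma primes_seq alpha z : star (relprime Lwrap hwrap) alpha ->
  set_prod alpha z -> ctx Lwrap z !=set0 ->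
  (exists i ps j, [/\ alpha = seqM i ps j, {in ps, forall p, P36 p} &
                      ps = [::] -> i = 0 \/ j = 0]) \/
  (exists i s j, s <> 1%g /\ alpha = seqW i s j).
Proof.
elim: alpha z => [|P alpha IHa] z.
  by move=> _ _ _; left; exists 0, [::], 0; split=> //; left.
move=> /star_cons[pP sa] [p Pp [z' az' <-]] lz.
have lz' : ctx Lwrap z' !=set0.
  by apply: (@ctx_infix p z' [::]); rewrite cats0.
have {}az' : set_prod alpha z' by exact: az'.
have {IHa} := IHa z' sa az' lz'.
have [e|e|[s s1 e]|[s s1 e]] := relprime_cases pP.
- move: pP Pp; rewrite {}e => _ e; rewrite {}e in lz.
  case=> [[i [ps [j [ea Pps f]]]]|[i [s [j [s1 ea]]]]]; last first.
    by right; exists i.+1, s, j; split=> //; rewrite ea.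
  left; exists i.+1, ps, j; split=> //; first by rewrite ea.
  (* Without a middle prime the rest is c^i d^j, and liveness after one more [c] forces [j = 0]. *)
  move=> p0; right; move: az';
    rewrite ea => /set_prod_seqMP[u ez /set_prod_Mab[_ eu]].
  move: lz; rewrite ez -[[:: gc]]/(nseq 1 gc) cat_word_c => /live_word.
  by case=> //; apply/eqP; rewrite eu p0.
- move: pP Pp; rewrite {}e => _ e; rewrite {}e in lz.
  have [nc nab] := live_after_d lz (mem_head _ _).
  case=> [[i [ps [j [ea Pps f]]]]|[i [s [j [s1 ea]]]]]; last first.
    move: az' nc; rewrite ea set_prod_seqW => /box_Wcl[n [u [n0 _ ->]]].
    by rewrite gc_word addn_gt0 n0 orbT.
  move: az' nc nab; rewrite ea => /set_prod_seqMP[u -> /set_prod_Mab[_ eu]].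
  rewrite gc_word has_ab_word eu lt0n !negbK => /eqP -> /eqP ->.
  by left; exists 0, [::], j.+1; split=> //; left.
- move: pP Pp; rewrite {}e => pM [u [u0 us] eu]; rewrite -{}eu in lz.
  have nc : gc \notin z'.
    apply: (live_after_ab lz); rewrite -word_u has_ab_word; exact/eqP.
  case=> [[i [ps [j [ea Pps f]]]]|[i [t [j [t1 ea]]]]]; last first.
    move: az' nc; rewrite ea set_prod_seqW => /box_Wcl[n [v [n0 _ ->]]].
    by rewrite gc_word addn_gt0 n0 orbT.
  move: az' nc; rewrite ea => /set_prod_seqMP[v -> _].
  rewrite gc_word lt0n negbK => /eqP ->; left; exists 0, (s :: ps), j;
    split=> //.
  by move=> q; rewrite inE => /orP[/eqP ->|/Pps].
- move: pP Pp; rewrite {}e => pM /Wcl_word[n [u [n0 ep _]]]; rewrite {}ep in lz.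
  have [nc nab] := live_after_d lz (etrans (gd_word _ _ _) n0).
  case=> [[i [ps [j [ea Pps f]]]]|[i [t [j [t1 ea]]]]]; last first.
    move: az' nc; rewrite ea set_prod_seqW => /box_Wcl[m [v [m0 _ ->]]].
    by rewrite gc_word addn_gt0 m0 orbT.
  move: az' nc nab; rewrite ea => /set_prod_seqMP[v -> /set_prod_Mab[_ ev]].
  rewrite gc_word has_ab_word ev lt0n !negbK => /eqP -> /eqP ->.
  by right; exists 0, s, j.
Qed.

Lemma star_nseq (T : eqType) (A : set T) x n : A x -> star A (nseq n x).
Proof. by move=> Ax y /nseqP[->]. Qed.

Lemma star_cat (T : eqType) (A : set T) s1 s2 :
  star A (s1 ++ s2) <-> star A s1 /\ star A s2.
Proof.
split=> [H|[H1 H2] x]; last by rewrite mem_cat => /orP[/H1|/H2].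
by split=> x xs; apply: H; rewrite mem_cat xs ?orbT.
Qed.

Lemma star_seqM i ps j : {in ps, forall p, P36 p} ->
  star (relprime Lwrap hwrap) (seqM i ps j).
Proof.
move=> H; apply/star_cat; split; first exact: star_nseq relprime_C.
apply/star_cat; split; last exact: star_nseq relprime_D.
by move=> _ /mapP[p /H[_ pM] ->].
Qed.

Lemma star_seqW i s j : s <> 1%g -> star (relprime Lwrap hwrap) (seqW i s j).
Proof.
move=> s1; apply/star_cat; split; first exact: star_nseq relprime_C.
rewrite -cat1s; apply/star_cat; split; last exact: star_nseq relprime_D.
by move=> Z; rewrite inE => /eqP ->; exact: relprime_W.
Qed.

Lemma unique_factorization X : relclass Lwrap hwrap X -> live Lwrap X ->
  X <> unitcl Lwrap hwrap -> exists! s, exact_factorization Lwrap hwrap X s.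
Proof.
move=> rX lX nu; have [i [Y [j [cY ij eX]]]] := live_box rX lX.
(* Competing factorizations have one of the two shapes of [primes_seq], so [alpha] is compared with
   these only. *)
have main alpha : star (relprime Lwrap hwrap) alpha -> set_prod alpha = X ->
    (forall beta, (exists i ps j, [/\ beta = seqM i ps j, {in ps, forall p, P36
      p} &
                      ps = [::] -> i = 0 \/ j = 0]) \/
       (exists i s j, s <> 1%g /\ beta = seqW i s j) ->
       set_prod beta = X -> alpha = beta) ->
    exists! s, exact_factorization Lwrap hwrap X s.
  move=> sa ea H; exists alpha; split.
    split=> //; split=> // a0; apply: nu.
    by rewrite -ea a0 cl_nil.
  move=> beta [[sb _] eb]; have [z Xz] := relclass_neq0 rX.
  apply: H => //; apply: (primes_seq sb (z := z)); first by rewrite eb.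
  exact: lX.
case: cY => [Y0|[s s1 [] Ys]].
- apply: (main (seqM i [::] j)); first exact: star_seqM.
    by rewrite set_prod_seqM /= embcl_nil eX Y0.
  have Xz : X (word i [::] j).
    by rewrite eX Y0; apply/boxE; exists [::] => //;
      rewrite -word_nil cat_word addn0.
  move=> beta [[i' [qs [j' [-> _ _]]]]|[i' [t [j' [_ ->]]]]] eb; move: Xz.
    rewrite -eb => /set_prod_seqMP[u /word_inj[-> <- ->] /set_prod_Mab[_]].
    by move=> /esym; rewrite eqxx => /eqP ->.
  by rewrite -eb set_prod_seqW => /box_Wcl[n [u [_ [u0 _] /word_inj[_ /esym]]]].
- have [ps [Pps eps ups]] := Mab_fact s1.
  have XM u : X (word i u j) <-> Mab s u.
    rewrite eX Ys; split=> [/boxE[_ /Mcl_word[v -> sv]]|su].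
      by rewrite cat_word => /word_inj[_ -> _].
    apply/boxE; exists (word 0 u 0); last by rewrite cat_word addn0.
    by apply/Mcl_word; exists u.
  have [u u0 us] := Mab_neq0 s1; have Mu : Mab s u by [].
  apply: (main (seqM i ps j)).
  + by apply: star_seqM => p /Pps/P36_Pab.
  + rewrite set_prod_seqM eps eX Ys.
    by rewrite -[embcl _]/(Mcl s).
  move=> beta [[i' [qs [j' [-> Pqs _]]]]|[i' [t [j' [t1 ->]]]]] eb.
    move: (Mu); rewrite -XM -eb => /set_prod_seqMP[v /word_inj[ei _ ej] _].
    rewrite ei ej (ups qs) //; first by move=> q /Pqs/P36_Pab.
    apply/seteqP; split=> w.
      move=> qw; apply/XM; rewrite -eb; apply/set_prod_seqMP.
      by exists w; rewrite // ei ej.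
    move=> /XM; rewrite -eb => /set_prod_seqMP[w' /word_inj[_ <- _]]; exact.
  move: Mu; rewrite -XM -eb set_prod_seqW.
  by move=> /box_Wcl[n [v [n0 _ /word_inj[ei _ ej]]]]; move: ij ei ej n0; lia.
- have [u u0 us] := Mab_neq0 s1; have Mu : Mab s u by [].
  have XW n : 0 < n -> X (word (i + n) u (j + n)).
    by move=> n0; rewrite eX Ys; apply/box_Wcl; exists n, u.
  apply: (main (seqW i s j)); first exact: star_seqW.
    by rewrite set_prod_seqW eX Ys.
  move=> beta [[i' [qs [j' [-> _ _]]]]|[i' [t [j' [t1 ->]]]]] eb.
    (* All words in the product of a [seqM] have the same number of [c], whereas [X] has members
       with different numbers. *)
    have := XW 1 isT; have := XW 2 isT; rewrite -eb.
    move=> /set_prod_seqMP[v /word_inj[e1 _ _] _].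
    by move=> /set_prod_seqMP[w /word_inj[e2 _ _] _]; lia.
  have := XW 1 isT; rewrite -eb set_prod_seqW.
  move=> /box_Wcl[n [v [n0 [_ vt] /word_inj[e1 uv e2]]]].
  (* The one-layer member of [X] gave i' <= i; the one-layer member of the product gives i <= i'. *)
  have : X (word (i' + 1) v (j' + 1)).
    rewrite -eb set_prod_seqW; apply/box_Wcl; exists 1, v; split=> //.
    by split=> //; rewrite -uv.
  rewrite eX Ys => /box_Wcl[m [w [m0 _ /word_inj[e3 _ e4]]]].
  have -> : i' = i by move: e1 e2 e3 e4 n0 m0; lia.
  have -> : j' = j by move: e1 e2 e3 e4 n0 m0; lia.
  by rewrite -us -vt uv.
Qed.

(** * Valid productions *)

Section QuotientProduct.
Variables (S : finType) (M : monoidType) (L : set (seq S)) (h : wordmorph S M).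

Lemma quot_prod_cl alpha z : star (relclass L h) alpha -> set_prod alpha z ->
  quot_prod L h alpha = cl L h z.
Proof.
elim: alpha z => [|P alpha IHa] z; first by move=> _ ->.
move=> /star_cons[rP ra] [p Pp [z' az' <-]] /=.
by rewrite (IHa z') // (relclass_cl rP Pp) qprodE.
Qed.

Lemma set_prod_neq0 alpha : star (relclass L h) alpha ->
  exists z, set_prod alpha z.
Proof.
elim: alpha => [|P alpha IHa]; first by exists [::].
move=> /star_cons[/relclass_neq0[p Pp] /IHa[z az]].
by exists (p ++ z); exists p => //; exists z.
Qed.

Lemma star_relprime alpha : star (relprime L h) alpha ->
  star (relclass L h) alpha.
Proof. by move=> H P /H[]. Qed.

Lemma size_set_prod alpha z : star (relprime L h) alpha -> set_prod alpha z ->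
  size alpha <= size z.
Proof.
elim: alpha z => [|P alpha IHa] z //.
move=> /star_cons[[rP _ nu _] sa] [p Pp [z' az' <-]].
rewrite size_cat /= -add1n leq_add ?IHa // lt0n size_eq0.
by apply/eqP => p0; apply: nu; rewrite p0 in Pp; exact: relclass_cl rP Pp.
Qed.

End QuotientProduct.

(** Primes omit the empty word, so a product of at least two contains only words of length at least
    2. *)
Lemma Val_letter P x : (P = [set [:: x]]) -> relprime Lwrap hwrap P ->
  Val Lwrap hwrap P = set0.
Proof.
move=> eP pP; apply/seteqP; split=> // alpha [[sa a2 ea] _].
have [z az] := set_prod_neq0 (star_relprime sa).
have sz := size_set_prod sa az.
have : P z.
  by rewrite -ea (quot_prod_cl (star_relprime sa) az); exact: theta_refl.
rewrite eP => ez; rewrite ez /= in sz.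
by have := leq_trans a2 sz.
Qed.

Lemma cl_word_M u : u <> [::] -> cl Lwrap hwrap (word 0 u 0) = Mcl (h36 u).
Proof.
move=> u0; apply/esym/relclass_cl; first exact: (Mcl_relclass (h36_neq1 u0)).1.
by apply/Mcl_word; exists u.
Qed.

Lemma cl_word_W n u : 0 < n -> u <> [::] ->
  cl Lwrap hwrap (word n u n) = Wcl (h36 u).
Proof.
move=> n0 u0; apply/esym/relclass_cl;
  first exact: (Wcl_relclass (h36_neq1 u0)).1.
by apply/Wcl_word; exists n, u.
Qed.

Lemma quot_prod_seqM i ps j : {in ps, forall p, P36 p} ->
  exists u, [/\ quot_prod Lwrap hwrap (seqM i ps j) = cl Lwrap hwrap (word i u
    j),
    h36 u = (\prod_(p <- ps) p)%g, (u == [::]) = (ps == [::]) &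
    set_prod (seqM i ps j) (word i u j)].
Proof.
move=> Pps; have sr : star (relclass Lwrap hwrap) (seqM i ps j).
  exact/star_relprime/star_seqM.
have [z az] := set_prod_neq0 sr.
move: (az) => /set_prod_seqMP[u ez /set_prod_Mab[pu nu]]; exists u.
by rewrite (quot_prod_cl sr az) -ez.
Qed.

Lemma prod_neq1 ps : ps <> [::] -> {in ps, forall p, P36 p} ->
  (\prod_(p <- ps) p)%g <> 1%g.
Proof.
move=> ps0 /(@quot_prod_seqM 0 ps 0)[u [_ <- nu _]].
by apply: h36_neq1; apply/eqP; rewrite nu; apply/eqP.
Qed.

Lemma quot_prod_Mcl ps : ps <> [::] -> {in ps, forall p, P36 p} ->
  quot_prod Lwrap hwrap (map Mcl ps) = Mcl (\prod_(p <- ps) p)%g.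
Proof.
move=> ps0 /(@quot_prod_seqM 0 ps 0)[u [+ <- nu _]].
rewrite /seqM /= cats0 => ->; apply: cl_word_M.
by apply/eqP; rewrite nu; apply/eqP.
Qed.

Lemma quot_prod_Mab ps : ps <> [::] -> {in ps, forall p, P36 p} ->
  quot_prod Lab h36 (map Mab ps) = Mab (\prod_(p <- ps) p)%g.
Proof.
move=> ps0 Pps.
have sr : star (relclass Lab h36) (map Mab ps).
  by move=> _ /mapP[p /Pps[p1 _] ->]; exact: relclass_Mab.
have [u pu] := set_prod_neq0 sr; have [eu nu] := set_prod_Mab pu.
rewrite (quot_prod_cl sr pu) -eu cl_Lab //.
by apply/eqP; rewrite nu; apply/eqP.
Qed.

Lemma Mab_inj s t : s <> 1%g -> Mab s = Mab t -> s = t.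
Proof.
by move=> /Mab_neq0[u u0 us] e; have [_ <-] : Mab t u by rewrite -e.
Qed.

Lemma Mcl_inj s t : s <> 1%g -> Mcl s = Mcl t -> s = t.
Proof. by move=> s1 /embcl_inj/(Mab_inj s1). Qed.

Lemma map_cat3 (T U : Type) (f : T -> U) s l m r : map f s = l ++ m ++ r ->
  exists l' m' r', [/\ s = l' ++ m' ++ r', l = map f l', m = map f m' & r = map
    f r'].
Proof.
move=> e; exists (take (size l) s), (take (size m) (drop (size l) s)),
  (drop (size m) (drop (size l) s)); rewrite !cat_take_drop; split=> //.
- by rewrite map_take e take_size_cat.
- by rewrite map_take map_drop e drop_size_cat // take_size_cat.
- by rewrite !map_drop e !drop_size_cat.
Qed.

(** Pleonasm stated in [M36], the common form for sequences of [Mcl] and of [Mab]. *)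
Definition pleo (ps : seq M36) : Prop := exists l m r,
  [/\ ps = l ++ m ++ r, 2 <= size m < size ps & P36 (\prod_(p <- m) p)%g].

Lemma in_infix (T : eqType) (P : T -> Prop) (l m r : seq T) :
  {in l ++ m ++ r, forall x, P x} -> {in m, forall x, P x}.
Proof. by move=> H x xm; apply: H; rewrite !mem_cat xm orbT. Qed.

Lemma size2_neq0 (T : Type) (s : seq T) : 2 <= size s -> s <> [::].
Proof. by case: s. Qed.

Lemma pleo_Mcl ps : {in ps, forall p, P36 p} ->
  (pleonastic Lwrap hwrap (map Mcl ps) <-> pleo ps).
Proof.
move=> Pps; split=> [[l [m [r [/map_cat3[l' [m' [r' [e _ -> _]]]]]]]]|].
  rewrite !size_map => sm; have Pm : {in m', forall p, P36 p}.
    by apply: (@in_infix _ _ l' m' r'); rewrite -e.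
  have m0 : m' <> [::] by apply: size2_neq0; case/andP: sm.
  rewrite quot_prod_Mcl // => pM; exists l', m', r'; split=> //.
  by split=> //; exact: prod_neq1.
move=> [l [m [r [e sm [_ pM]]]]]; exists (map Mcl l), (map Mcl m), (map Mcl r).
rewrite !size_map e !map_cat -e; split=> //; rewrite quot_prod_Mcl //.
  by apply: size2_neq0; case/andP: sm.
by apply: (@in_infix _ _ l m r); rewrite -e.
Qed.

Lemma pleo_Mab ps : {in ps, forall p, P36 p} ->
  (pleonastic Lab h36 (map Mab ps) <-> pleo ps).
Proof.
move=> Pps; split=> [[l [m [r [/map_cat3[l' [m' [r' [e _ -> _]]]]]]]]|].
  rewrite !size_map => sm; have Pm : {in m', forall p, P36 p}.
    by apply: (@in_infix _ _ l' m' r'); rewrite -e.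
  have m0 : m' <> [::] by apply: size2_neq0; case/andP: sm.
  rewrite quot_prod_Mab // => /relprime_Lab[s Ps eM]; exists l', m', r';
    split=> //.
  by rewrite (Mab_inj _ eM); [apply/P36_Pab|exact: prod_neq1].
move=> [l [m [r [e sm Pm]]]]; exists (map Mab l), (map Mab m), (map Mab r).
rewrite !size_map e !map_cat -e; split=> //; rewrite quot_prod_Mab //.
- by apply/relprime_Lab; eexists; first exact/P36_Pab/Pm.
- by apply: size2_neq0; case/andP: sm.
- by apply: (@in_infix _ _ l m r); rewrite -e.
Qed.

(** Members of [Mcl p] contain no [c] or [d], so only sequences of [Mcl] remain; the condition left
    is the one in [Val_M_Lab]. *)
Lemma Val_M p : P36 p -> Val Lwrap hwrap (Mcl p) =
  [set map Mcl ps | ps in [set ps | [/\ {in ps, forall p, P36 p}, 2 <= size ps,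
     (\prod_(q <- ps) q)%g = p & ~ pleo ps]]].
Proof.
move=> [p1 pM]; apply/seteqP; split=> [alpha [[sa a2 ea] np]|].
  have [z az] := set_prod_neq0 (star_relprime sa).
  have ez := quot_prod_cl (star_relprime sa) az.
  have Mz : Mcl p z by rewrite -ea ez; exact: theta_refl.
  have lz : ctx Lwrap z !=set0 by case: pM => _ + _ _; apply.
  have [u zu Mu] := (Mcl_word p z).1 Mz.
  have [[i [ps [j [e Pps _]]]]|[i [s [j [_ e]]]]] := primes_seq sa az lz;
    last first.
    move: az; rewrite e set_prod_seqW => /box_Wcl[n [v [n0 _]]].
    by rewrite zu => /word_inj[]; lia.
  have /set_prod_seqMP[v] : set_prod (seqM i ps j) z by rewrite -e.
  rewrite zu => /word_inj[i0 _ j0] _.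
  have {}e : alpha = map Mcl ps by rewrite e -i0 -j0 /seqM cats0.
  rewrite e size_map in a2; rewrite e in np.
  exists ps => //; split=> //; last by move/(pleo_Mcl Pps).
  apply/esym/(Mcl_inj p1); rewrite -quot_prod_Mcl //; last exact: size2_neq0.
  by rewrite -e ea.
move=> _ [ps [Pps ps2 eps np] <-]; split; last by move/(pleo_Mcl Pps).
split; first by move=> _ /mapP[q /Pps[_ qM] ->].
  by rewrite size_map.
by rewrite quot_prod_Mcl ?eps //; exact: size2_neq0.
Qed.

Lemma Val_M_Lab p : P36 p -> Val Lab h36 (Mab p) =
  [set map Mab ps | ps in [set ps | [/\ {in ps, forall p, P36 p}, 2 <= size ps,
     (\prod_(q <- ps) q)%g = p & ~ pleo ps]]].
Proof.
move=> [p1 pM]; apply/seteqP; split=> [alpha [[sa a2 ea] np]|].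
  have [ps e Pps] : exists2 ps, alpha = map Mab ps & {in ps, forall p, P36 p}.
    elim: alpha sa {a2 ea np} => [|P alpha IHa]; first by exists [::].
    move=> /star_cons[/relprime_Lab[q Pq ->] /IHa[ps -> Pps]];
      exists (q :: ps) => //.
    by move=> q'; rewrite inE => /orP[/eqP ->|/Pps //]; apply/P36_Pab.
  rewrite e size_map in a2; rewrite e in np.
  exists ps => //; split=> //; last by move/(pleo_Mab Pps).
  apply/esym/(Mab_inj p1); rewrite -quot_prod_Mab //; last exact: size2_neq0.
  by rewrite -e ea.
move=> _ [ps [Pps ps2 eps np] <-]; split; last by move/(pleo_Mab Pps).
split; first by move=> _ /mapP[q /Pps/P36_Pab Pq ->]; apply/relprime_Lab;
  exists q.
  by rewrite size_map.
by rewrite quot_prod_Mab ?eps //; exact: size2_neq0.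
Qed.

Lemma Val_M_embcl p : P36 p ->
  Val Lwrap hwrap (Mcl p) = map embcl @` Val Lab h36 (Mab p).
Proof.
move=> Pp; rewrite Val_M // Val_M_Lab //; apply/seteqP; split.
  move=> _ [ps H <-]; exists (map Mab ps); first by exists ps.
  by rewrite -map_comp.
by move=> _ [_ [ps H <-] <-]; exists ps => //; rewrite -map_comp.
Qed.

Lemma mu_map_Mcl ps : {in ps, forall p, P36 p} ->
  mu (map Mcl ps) = (\prod_(p <- ps) p)%g.
Proof.
elim: ps => [|p ps IHps] H; first by rewrite wm_nil big_nil.
rewrite map_cons -cat1s wm_cat big_cons mu_Mcl; last by apply: H;
  rewrite mem_head.
by rewrite IHps // => q qs; apply: H; rewrite inE qs orbT.
Qed.

Lemma star_Amid alpha : star Amid alpha <->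
  exists2 ps, alpha = map Mcl ps & {in ps, forall p, P36 p}.
Proof.
split=> [|[ps -> Pps] _ /mapP[p /Pps Pp ->]]; last by exists p.
elim: alpha => [|P alpha IHa]; first by exists [::].
move=> /star_cons[[q Pq <-] /IHa[ps -> Pps]]; exists (q :: ps) => //.
by move=> q'; rewrite inE => /orP[/eqP ->|/Pps //].
Qed.

(** Excludes prime quotient products for blocks containing only one of the outer [Ccl] and [Dcl]. *)
Lemma prime_balanced i u j : u <> [::] ->
  relprime Lwrap hwrap (cl Lwrap hwrap (word i u j)) -> i = j.
Proof.
move=> u0 pP; set P := cl _ _ _ in pP;
  have Pw : P (word i u j) by exact: theta_refl.
have [e|e|[s s1 e]|[s s1 e]] := relprime_cases pP.
- by move: Pw; rewrite e /Ccl /= -[[:: gc]]/(nseq 1 gc) -word_c =>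
    /word_inj[_ /u0].
- by move: Pw; rewrite e /Dcl /= -[[:: gd]]/(nseq 1 gd) -word_d =>
    /word_inj[_ /u0].
- by move: Pw; rewrite e => /Mcl_word[v /word_inj[-> _ ->]].
- by move: Pw; rewrite e => /Wcl_word[n [v [_ /word_inj[-> _ ->]]]].
Qed.

Lemma infix_bracket (T : Type) (x y : T) s l m r :
  x :: s ++ [:: y] = l ++ m ++ r -> 2 <= size m < size (x :: s ++ [:: y]) ->
  [\/ exists m' r', [/\ m = x :: m', m' <> [::] & s = m' ++ r'],
      exists l' m', [/\ m = rcons m' y, m' <> [::] & s = l' ++ m'] |
      exists l' r', s = l' ++ m ++ r'].
Proof.
case: l => [|x' l] /=.
  case: m => [|x' m] //= [<-]; case/lastP: r => [|r y'].
    by rewrite cats0 => ->; rewrite ltnn andbF.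
  rewrite -cats1 catA !cats1 => /rcons_inj[-> _] /andP[m2 _].
  by constructor 1; exists m, r; split=> //; move: m2; case: (m).
move=> [_]; case/lastP: r => [|r y'].
  rewrite cats0; case/lastP: m => [|m y'] //.
  rewrite -rcons_cat cats1 => /rcons_inj[-> ->] /andP[m2 _].
  by constructor 2; exists l, m; split=> //; move: m2; rewrite size_rcons;
    case: (m).
rewrite -!rcons_cat cats1 => /rcons_inj[-> _] _.
by constructor 3; exists l, r.
Qed.

Lemma nseqSr (T : Type) (x : T) n : nseq n.+1 x = nseq n x ++ [:: x].
Proof. by rewrite -addn1 nseqD. Qed.

Lemma seqM_S i ps j : seqM i.+1 ps j.+1 = [:: Ccl] ++ seqM i ps j ++ [:: Dcl].
Proof. by rewrite /seqM (nseqSr _ j) -!catA. Qed.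

Lemma seqW_S i s j : seqW i.+1 s j.+1 = [:: Ccl] ++ seqW i s j ++ [:: Dcl].
Proof. by rewrite /seqW (nseqSr _ j) /= -catA. Qed.

Lemma size_seqM i ps j : size (seqM i ps j) = i + (size ps + j).
Proof. by rewrite !size_cat !size_nseq size_map. Qed.

Lemma size_seqW i s j : size (seqW i s j) = i + j.+1.
Proof. by rewrite !size_cat /= !size_nseq. Qed.

Lemma quot_prod_seqMn n ps : 0 < n -> ps <> [::] -> {in ps, forall p, P36 p} ->
  quot_prod Lwrap hwrap (seqM n ps n) = Wcl (\prod_(p <- ps) p)%g.
Proof.
move=> n0 ps0 /(@quot_prod_seqM n ps n)[u [-> <- nu _]]; apply: cl_word_W => //.
by apply/eqP; rewrite nu; apply/eqP.
Qed.

Lemma quot_prod_seqW i s j : s <> 1%g -> exists2 u, Mab s u &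
  quot_prod Lwrap hwrap (seqW i s j) = cl Lwrap hwrap (word i.+1 u j.+1).
Proof.
move=> s1; have [u u0 us] := Mab_neq0 s1; exists u => //.
apply: quot_prod_cl; first exact/star_relprime/star_seqW.
rewrite set_prod_seqW; apply/box_Wcl; exists 1, u; split=> //.
by rewrite !addn1.
Qed.

Lemma quot_prod_seqWn n s : s <> 1%g ->
  quot_prod Lwrap hwrap (seqW n s n) = Wcl s.
Proof.
by move=> s1; have [u [u0 <-] ->] := quot_prod_seqW n n s1; exact: cl_word_W.
Qed.

(** The only proper blocks of length 2 are C W_s and W_s D, which are unbalanced. *)
Lemma seqW_nonpleo s : s <> 1%g -> ~ pleonastic Lwrap hwrap (seqW 1 s 1).
Proof.
move=> s1 [l [m [r [/(@infix_bracket _ Ccl Dcl [:: Wcl s]) H sm pm]]]].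
case: (H sm) => [[m' [r' [em m0]]]|[l' [m' [em m0]]]|[l' [r']]].
- case: m' m0 em => // W m' _ em [eW /esym/nilP];
    rewrite /nilp size_cat addn_eq0.
  move=> /andP[/nilP m0 _]; move: em pm; rewrite m0 -eW => ->.
  have [u [u0 _] e] := quot_prod_seqW 1 0 s1.
  by rewrite -[[:: _; _]]/(seqW 1 s 0) e => /(prime_balanced u0).
- case/lastP: m' m0 em => // m' W _ em;
    rewrite -rcons_cat -[[:: Wcl s]]/(rcons [::] _).
  move=> /rcons_inj[/esym/nilP]; rewrite /nilp size_cat addn_eq0.
  move=> /andP[_ /nilP m0] eW; move: em pm; rewrite m0 -eW => ->.
  have [u [u0 _] e] := quot_prod_seqW 0 1 s1.
  by rewrite -[rcons _ _]/(seqW 0 s 1) e => /(prime_balanced u0).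
- move=> /(congr1 size); rewrite !size_cat /= => e.
  have : size m <= 1 by rewrite e addnCA leq_addr.
  by case/andP: sm => m2 _; rewrite leqNgt m2.
Qed.

Lemma Icl_seq s alpha : Icl s alpha <-> exists ps,
  [/\ alpha = map Mcl ps, {in ps, forall p, P36 p}, ps <> [::],
      (\prod_(p <- ps) p)%g = s &
      forall l m r, ps = l ++ m ++ r -> 2 <= size m ->
        ~ P36 (\prod_(p <- m) p)%g].
Proof.
split=> [[[es [/star_Amid[ps ea Pps] a0]] nc]|[ps [-> Pps ps0 <- nc]]].
  exists ps; split=> //.
  - by move=> p0; apply: a0; rewrite ea p0.
  - by rewrite -mu_map_Mcl // -ea.
  move=> l m r e m2 Pm; apply: nc; rewrite ea e !map_cat catA.
  have [Pl Pm' Pr] : [/\ {in l, forall p, P36 p}, {in m, forall p, P36 p} &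
                         {in r, forall p, P36 p}].
    by split=> p pI; apply: Pps; rewrite e !mem_cat pI ?orbT.
  exists (map Mcl l ++ map Mcl m); last by exists (map Mcl r) => //;
    apply/star_Amid; exists r.
  exists (map Mcl l); first by apply/star_Amid; exists l.
  exists (map Mcl m) => //; split; rewrite ?size_map ?mu_map_Mcl //.
  by apply/star_Amid; exists m.
split.
  split; first exact: mu_map_Mcl.
  by split; [apply/star_Amid; exists ps | case: (ps) ps0].
move=> [_ [L _ [M [_ M2 PM] <-]] [R _]]; rewrite -catA => /esym/map_cat3.
move=> [l [m [r [e _ em _]]]]; apply: (nc l m r e).
  by rewrite em size_map in M2.
rewrite -mu_map_Mcl -?em //.
by apply: (@in_infix _ _ l m r); rewrite -e.
Qed.

(** A proper block with one bracket is unbalanced, and a block inside the middle is excluded by the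
    definition of [Icl]. *)
Lemma seqM_nonpleo s ps : Icl s (map Mcl ps) -> {in ps, forall p, P36 p} ->
  ~ pleonastic Lwrap hwrap (seqM 1 ps 1).
Proof.
move=> [_ nc] Pps [l [m [r [/(@infix_bracket _ Ccl Dcl (map Mcl ps)) H sm
  pm]]]].
have bal i ms j l0 r0 : ps = l0 ++ ms ++ r0 -> ms <> [::] ->
    relprime Lwrap hwrap (quot_prod Lwrap hwrap (seqM i ms j)) -> i = j.
  move=> e ms0; have Pms : {in ms, forall p, P36 p}.
    by apply: (@in_infix _ _ l0 ms r0); rewrite -e.
  have [u [-> _ nu _]] := quot_prod_seqM i j Pms; apply: prime_balanced.
  by apply/eqP; rewrite nu; apply/eqP.
case: (H sm) => [[m' [r' [em m0 e]]]|[l' [m' [em m0 e]]]|[l' [r' e]]].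
- have [l0 [ms [r0 [eps _ ems _]]]] := @map_cat3 _ _ Mcl ps [::] m' r' e.
  have ms0 : ms <> [::] by move=> ms0; apply: m0; rewrite ems ms0.
  suff : 1 = 0 by []; apply: (bal _ ms _ _ _ eps ms0).
  by rewrite /seqM cats0 -ems -[nseq 1 Ccl ++ m']/(Ccl :: m') -em.
- rewrite -[m']cats0 in e.
  have [l0 [ms [r0 [eps _ ems _]]]] := @map_cat3 _ _ Mcl ps l' m' [::] e.
  have ms0 : ms <> [::] by move=> ms0; apply: m0; rewrite ems ms0.
  suff : 0 = 1 by []; apply: (bal _ ms _ _ _ eps ms0).
  by rewrite /seqM -ems [nseq 0 _ ++ _]/= cats1 -em.
have [l0 [ms [r0 [eps el ems er]]]] := @map_cat3 _ _ Mcl ps l' m r' e.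
have Pall : [/\ {in l0, forall p, P36 p}, {in ms, forall p, P36 p} &
                         {in r0, forall p, P36 p}].
  by split=> p pI; apply: Pps; rewrite eps !mem_cat pI ?orbT.
have [Pl Pm Pr] := Pall; have m2 : 2 <= size m by case/andP: sm.
have ms0 : ms <> [::] by move=> ms0; rewrite ems ms0 in m2.
apply: nc; exists (l' ++ m).
  exists l'; first by apply/star_Amid; exists l0.
  exists m => //; split=> //; first by apply/star_Amid; exists ms.
  rewrite ems mu_map_Mcl //; split; first exact: prod_neq1.
  by rewrite -quot_prod_Mcl // -ems.
exists r'; first by apply/star_Amid; exists r0.
by rewrite e catA.
Qed.

Lemma Val_W s : s <> 1%g -> Val Lwrap hwrap (Wcl s) =
  [set [:: Ccl; Wcl s; Dcl]] `|`
  conc (conc [set [:: Ccl]] (Icl s)) [set [:: Dcl]].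
Proof.
move=> s1; apply/seteqP; split=> [alpha [[sa a2 ea] np]|alpha].
  have [z az] := set_prod_neq0 (star_relprime sa).
  have ez := quot_prod_cl (star_relprime sa) az.
  have Wz : Wcl s z by rewrite -ea ez; exact: theta_refl.
  have lz : ctx Lwrap z !=set0 by apply: (Wcl_relclass s1).2.
  have [n [u [n0 zu [u0 us]]]] := (Wcl_word s z).1 Wz.
  have [[i [ps [j [e Pps _]]]]|[i [t [j [t1 e]]]]] := primes_seq sa az lz.
    have /set_prod_seqMP[v zv /set_prod_Mab[pv nv]] : set_prod (seqM i ps j) z.
      by rewrite -e.
    move: zv; rewrite zu => /word_inj[ni uv nj].
    have ps0 : ps <> [::].
      by apply/eqP; rewrite -nv -uv; apply/eqP.
    have prod_ps : (\prod_(p <- ps) p)%g = s by rewrite -pv -uv us.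
    have eij : alpha = seqM n ps n by rewrite e -ni -nj.
    case: n n0 eij {zu ni nj} => // -[_|n _] eij.
      right; exists ([:: Ccl] ++ map Mcl ps); last by exists [:: Dcl];
        rewrite // eij.
      exists [:: Ccl] => //; exists (map Mcl ps) => //; apply/Icl_seq.
      exists ps; split=> // l m r eps m2 Pm; apply: np.
      rewrite eij eps; exists (Ccl :: map Mcl l), (map Mcl m), (map Mcl r ++
        [:: Dcl]).
      have Pms : {in m, forall p, P36 p}.
        by apply: (@in_infix _ _ l m r); rewrite -eps.
      split; first by rewrite /seqM !map_cat /= -!catA.
        by rewrite size_seqM size_map !size_cat; move: m2; lia.
      by rewrite quot_prod_Mcl //; [case: Pm|exact: size2_neq0].
    (* With two or more layers, the block inside the outermost brackets has quotient product
       [Wcl s], a prime. *)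
    case: np; rewrite eij seqM_S;
      exists [:: Ccl], (seqM n.+1 ps n.+1), [:: Dcl].
    split=> //; last by rewrite quot_prod_seqMn // prod_ps; exact: relprime_W.
    by rewrite -seqM_S !size_seqM; case: (ps) ps0 => //= *; lia.
  have : set_prod (seqW i t j) z by rewrite -e.
  rewrite set_prod_seqW => /box_Wcl[m [v [m0 [v0 vt]]]].
  rewrite zu => /word_inj[ni uv nj].
  have et : t = s by rewrite -vt -uv us.
  have ij : i = j by lia.
  (* Zero layers give a sequence of length 1, one layer gives C W_s D, and more layers are
     pleonastic. *)
  rewrite {}et -{}ij in e; case: i e {ni nj} => [|[|i]] e;
    first by rewrite e in a2.
    by left.
  case: np; rewrite e seqW_S; exists [:: Ccl], (seqW i.+1 s i.+1), [:: Dcl].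
  split=> //; last by rewrite quot_prod_seqWn //; exact: relprime_W.
  by rewrite -seqW_S !size_seqW; lia.
case=> [->|[_ [_ -> [beta Ib <-]] [_ -> <-]]].
  split; last exact: seqW_nonpleo.
  split=> //; first exact: (@star_seqW 1 s 1).
  exact: (quot_prod_seqWn 1 s1).
have [ps [eb Pps ps0 pr _]] := (Icl_seq s beta).1 Ib; rewrite eb in Ib *.
rewrite -catA -[_ ++ _]/(seqM 1 ps 1); split; last exact: seqM_nonpleo Ib Pps.
split; first exact: star_seqM.
  by rewrite size_seqM; case: (ps) ps0 => //= *; lia.
by rewrite quot_prod_seqMn // pr.
Qed.

(** * Regularity of the valid-return languages *)

(** The Myhill-Nerode criterion: the finite-valued [f] refines equality of right residuals. One
    implication is enough, since the condition is symmetric in [u] and [v]. *)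
Definition recog (T : Type) (K : set (seq T)) : Prop :=
  exists (Q : finType) (f : seq T -> Q),
    forall u v, f u = f v -> forall w, K (u ++ w) -> K (v ++ w).

(* The state reached by [w] is [f] of a word with the same residual as [w]:
   [f] need not be compatible with concatenation. *)
Lemma recog_regular (T : eqType) (A : set T) (K : set (seq T)) :
  finite_set A -> K `<=` star A -> recog K -> regular A K.
Proof.
move=> fA KA [Q [f Hf]]; split=> //.
pose r q : seq T :=
  if pselect (exists u, f u = q) is left ex then projT1 (cid ex) else [::].
have fr u : f (r (f u)) = f u.
  rewrite /r; case: pselect => [ex|[]]; last by exists u.
  exact: (projT2 (cid ex)).
pose delta q x := f (r q ++ [:: x]).
exists Q, (f [::]), delta, [set q | `[< K (r q) >]]%SET => w _.
have H u z : K (r (foldl delta (f [::]) u) ++ z) <-> K (u ++ z).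
  elim/last_ind: u z => [|u x IHu] z /=.
    by split; [exact: (Hf _ [::] (fr _)) | exact: (Hf [::] _ (esym (fr _)))].
  rewrite -cats1 foldl_cat; move: (foldl _ _ u) IHu => q IHu.
  have := IHu ([:: x] ++ z); rewrite !catA => <-.
  by rewrite -[foldl _ q [:: x]]/(f (r q ++ [:: x])); split; apply: Hf;
    rewrite fr.
by rewrite inE -[w in K w]cats0 -H cats0; split=> /asboolP.
Qed.

Lemma recogI (T : Type) (K L : set (seq T)) :
  recog K -> recog L -> recog (K `&` L).
Proof.
move=> [Q [f Hf]] [Q' [f' Hf']]; exists (Q * Q')%type, (fun u => (f u, f' u)).
by move=> u v [e e'] w [Ku Lu]; split; [exact: Hf Ku|exact: Hf' Lu].
Qed.

Lemma recogC (T : Type) (K : set (seq T)) : recog K -> recog (~` K).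
Proof.
by move=> [Q [f Hf]]; exists Q, f => u v e w nKu Kv; apply: nKu; exact: Hf Kv.
Qed.

Lemma recogU (T : Type) (K L : set (seq T)) :
  recog K -> recog L -> recog (K `|` L).
Proof.
by move=> rK rL; rewrite -[_ `|` _]setCK setCU; apply/recogC/recogI;
  exact: recogC.
Qed.

Lemma cat_eq_cat (T : Type) (u w y z : seq T) : u ++ w = y ++ z ->
  (exists x, u = y ++ x /\ z = x ++ w) \/ (exists x, y = u ++ x /\ w = x ++ z).
Proof.
elim: u y => [|a u IHu] [|b y] /=.
- by move=> ->; left; exists [::].
- by move=> ->; right; exists (b :: y).
- by move=> <-; left; exists (a :: u).
by move=> [-> /IHu[[x [-> ->]]|[x [-> ->]]]]; [left|right]; exists x.
Qed.

(** A subset construction: [S u] collects the [f']-values of the suffixes of [u] left after a prefix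
    in [K], for cuts inside [u]; [f u] handles cuts inside the continuation. *)
Lemma recog_conc (T : Type) (K L : set (seq T)) :
  recog K -> recog L -> recog (conc K L).
Proof.
move=> [Q [f Hf]] [Q' [f' Hf']].
pose S u : {set Q'} :=
  [set q | `[< exists y x, [/\ u = y ++ x, K y & f' x = q] >]]%SET.
exists (Q * {set Q'})%type, (fun u => (f u, S u)) => u v [e eS] w.
move=> [y Ky [z Lz /esym/cat_eq_cat[[x [eu ez]]|[x [ey ew]]]]].
  have : f' x \in S u by rewrite inE; apply/asboolP; exists y, x.
  rewrite eS inE => /asboolP[y' [x' [-> Ky' ex']]].
  exists y' => //; exists (x' ++ w); last by rewrite catA.
  by apply: (Hf' x x') => //; rewrite -ez.
exists (v ++ x); last by exists z; rewrite // ew catA.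
by apply: (Hf u v e); rewrite -ey.
Qed.

Lemma recogT (T : Type) : recog [set: seq T].
Proof. by exists unit, (fun=> tt). Qed.

Lemma recog_nil (T : Type) : recog [set [::] : seq T].
Proof.
by exists bool, (fun u => nilp u) => -[|x u] [|y v].
Qed.

Lemma recog_letter (T : eqType) (x : T) : recog [set [:: x]].
Proof.
exists (bool * bool)%type, (fun u => (u == [::], u == [:: x])) =>
  u v [e1 e2] w /=.
case: u e1 e2 => [|y u] e1 e2; first by rewrite -(eqP (esym e1)) .
by case=> yx /nilP; rewrite /nilp size_cat addn_eq0 => /andP[/nilP u0 /nilP ->];
  move: e2; rewrite yx u0 eqxx => /esym/eqP ->.
Qed.

Lemma recog_star (T : eqType) (A : set T) : recog (star A).
Proof.
exists bool, (fun u => `[< star A u >]) => u v e w /star_cat[su sw].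
by apply/star_cat; split=> //; apply/asboolP; rewrite -e; apply/asboolP.
Qed.

Lemma recog_morph (T : Type) (Q : finType) (op : Q -> Q -> Q) (phi : seq T -> Q)
  (B : set Q) : (forall u v, phi (u ++ v) = op (phi u) (phi v)) ->
  recog (phi @^-1` B).
Proof. by move=> H; exists Q, phi => u v e w; rewrite /= !H e. Qed.

Lemma recog_mu (B : set M36) : recog (mu @^-1` B).
Proof. exact/recog_morph/wm_cat. Qed.

Definition nonnil (T : Type) : set (seq T) := ~` [set [::]].

Lemma recog_nonnil (T : Type) : recog (@nonnil T).
Proof. exact/recogC/recog_nil. Qed.

(** Length at least 2 is written as a product of two nonempty words, so the closure properties of
    [recog] apply. *)
Lemma Corr_midE :
  Corr_mid = star Amid `&` conc (@nonnil _) (@nonnil _) `&` mu @^-1` P36.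
Proof.
apply/seteqP; split=> beta.
  move=> [sb b2 Pb]; do 2!split=> //;
    case: beta b2 {sb Pb} => [|X [|Y beta]] // _.
  by exists [:: X] => //; exists (Y :: beta).
move=> [[sb [u u0 [v v0 euv]]] Pb]; split; [exact: sb| |exact: Pb].
rewrite -euv size_cat {euv}.
by case: u u0 {sb Pb} => [/(_ erefl) //|X u _];
  case: v v0 => [/(_ erefl) //|Y v _];
  rewrite /= addnS.
Qed.

Lemma recog_Corr_mid : recog Corr_mid.
Proof.
rewrite Corr_midE; apply: recogI; last exact: recog_mu.
by apply: recogI; [exact: recog_star|apply: recog_conc; exact: recog_nonnil].
Qed.

Lemma recog_Icl s : recog (Icl s).
Proof.
rewrite /Icl setDE; apply: recogI.
  apply: recogI; first exact: recog_mu.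
  exact: (recogI (recog_star Amid) (recog_nonnil _)).
apply: recogC; apply: recog_conc; last exact: recog_star.
by apply: recog_conc; [exact: recog_star|exact: recog_Corr_mid].
Qed.

(** A block is proper when something nonempty stands to its left or to its right, whence the
    union. *)
Lemma Val_ME p : P36 p -> Val Lwrap hwrap (Mcl p) =
  (star Amid `&` conc (@nonnil _) (@nonnil _) `&` mu @^-1` [set p]) `&`
  ~` (conc (@nonnil _) (conc Corr_mid setT) `|`
      conc setT (conc Corr_mid (@nonnil _))).
Proof.
move=> Pp.
have -> : star Amid `&` conc (@nonnil _) (@nonnil _) `&` mu @^-1` [set p] =
    [set alpha | [/\ star Amid alpha, 2 <= size alpha & mu alpha = p]].
  apply/seteqP; split=> alpha.
    move=> [[sa [u u0 [v v0 euv]]] Pb]; split; [exact: sa| |exact: Pb].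
    rewrite -euv size_cat {euv}.
    by case: u u0 {sa Pb} => [/(_ erefl) //|X u _];
      case: v v0 => [/(_ erefl) //|Y v _];
  rewrite /= addnS.
  move=> [sb b2 Pb]; do 2!split=> //;
    case: alpha b2 {sb Pb} => [|X [|Y beta]] // _.
  by exists [:: X] => //; exists (Y :: beta).
rewrite Val_M //; apply/seteqP; split.
  move=> _ [ps [Pps ps2 eps np] <-]; split.
    by split; [apply/star_Amid;
      exists ps | rewrite size_map | rewrite mu_map_Mcl].
  have H l m r : map Mcl ps = l ++ m ++ r -> 0 < size l + size r ->
    ~ Corr_mid m.
    move=> /map_cat3[l' [m' [r' [e el em er]]]] lr [sm m2 Pm].
    apply: np; exists l', m', r'; split=> //.
      move: lr m2; rewrite el em er e !size_cat !size_map => lr m2.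
      by rewrite m2; move: lr; lia.
    rewrite -mu_map_Mcl -?em //.
    by apply: (@in_infix _ _ l' m' r'); rewrite -e.
  case=> [[l l0 [_ [m Cm [r _ <-]] /esym e]]|[l _ [_ [m Cm [r r0 <-]] /esym
    e]]].
    by apply: H e _ Cm; case: l l0 => [/(_ erefl)|].
  by apply: H e _ Cm; case: r r0 => [/(_ erefl) //|*]; rewrite addnS.
move=> alpha [[/star_Amid[ps -> Pps] ps2 eps] nc]; exists ps => //.
rewrite size_map in ps2; split=> //; first by rewrite -mu_map_Mcl.
move=> [l [m [r [e /andP[m2 ms] Pm]]]]; apply: nc.
have Pms : {in m, forall p, P36 p}.
  by apply: (@in_infix _ _ l m r); rewrite -e.
have Cm : Corr_mid (map Mcl m).
  by split; [apply/star_Amid; exists m | rewrite size_map | rewrite mu_map_Mcl].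
rewrite e !map_cat; case: l e => [|x l] e; [right|left].
  exists [::] => //; exists (map Mcl m ++ map Mcl r) => //.
  exists (map Mcl m) => //; exists (map Mcl r) => //.
  by case: r e => // e; move: ms; rewrite e /= cats0 ltnn.
exists (map Mcl (x :: l)) => //; exists (map Mcl m ++ map Mcl r) => //.
by exists (map Mcl m) => //; exists (map Mcl r).
Qed.

Lemma recog_Val_M p : P36 p -> recog (Val Lwrap hwrap (Mcl p)).
Proof.
move=> Pp; rewrite Val_ME //; apply: recogI.
  apply: recogI; last exact: recog_mu.
  by apply: recogI; [exact: recog_star|apply: recog_conc; exact: recog_nonnil].
apply: recogC; apply: recogU; apply: recog_conc.
- exact: recog_nonnil.
- by apply: recog_conc; [exact: recog_Corr_mid|exact: recogT].
- exact: recogT.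
- by apply: recog_conc; [exact: recog_Corr_mid|exact: recog_nonnil].
Qed.

Lemma recog_word (T : eqType) (w : seq T) : recog [set w].
Proof.
elim: w => [|x w IHw]; first exact: recog_nil.
suff -> : [set x :: w] = conc [set [:: x]] [set w].
  by apply: recog_conc => //; exact: recog_letter.
by apply/seteqP; split=> [_ ->|_ [_ -> [_ -> <-]]] //; exists [:: x] => //;
  exists w.
Qed.

Lemma recog_Val_W s : s <> 1%g -> recog (Val Lwrap hwrap (Wcl s)).
Proof.
move=> s1; rewrite Val_W //; apply: recogU; first exact: recog_word.
apply: recog_conc; last exact: recog_word.
by apply: recog_conc; [exact: recog_word|exact: recog_Icl].
Qed.

Lemma finite_relprime : finite_set (relprime Lwrap hwrap).
Proof.
rewrite relprime_Lwrap !finite_setU; split; first split.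
- by split; exact: finite_set1.
- exact/finite_image/finite_finset.
- exact/finite_image/finite_finset.
Qed.

Lemma FSRP_Lwrap : FSRP Lwrap hwrap.
Proof.
split=> [|P pP]; first exact: finite_relprime.
apply: recog_regular; first exact: finite_relprime.
  by move=> alpha [[]].
have r0 : recog (set0 : set (seq (set (seq Gamma)))).
  by exists unit, (fun=> tt).
have [e|e|[s s1 e]|[s s1 e]] := relprime_cases pP.
- by rewrite (Val_letter e).
- by rewrite (Val_letter e).
- by rewrite e; apply: recog_Val_M; split=> //; rewrite -e.
- by rewrite e; exact: recog_Val_W.
Qed.

(** * The language [Lwrap] *)

Lemma pigeonhole (Q : finType) (f : nat -> Q) : exists m n, m <> n /\ f m = f n.
Proof.
have [/injectiveP fI|/injectivePn[i [j ij e]]] :=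
    boolP (injectiveb (fun i : 'I_#|Q|.+1 => f i)).
  by have := leq_card _ fI; rewrite card_ord ltnn.
by exists i, j; split=> // /val_inj eij; rewrite eij eqxx in ij.
Qed.

(** Two different powers of [c] reach the same state, but [a d^m] completes only one of them to a
    word of the language. *)
Lemma Lwrap_not_regular : ~ regular setT Lwrap.
Proof.
move=> [_ _ [Q [q0 [delta [F H]]]]].
have [m [n [mn e]]] := pigeonhole (fun n => foldl delta q0 (nseq n gc)).
have {}H (w : seq Gamma) : Lwrap w <-> foldl delta q0 w \in F by exact: H.
have Lm : Lwrap (nseq m gc ++ word 0 [:: la] m).
  by exists m, [:: la]; split=> //; rewrite cat_word_c addn0.
have : Lwrap (nseq n gc ++ word 0 [:: la] m).
  apply: (H _).2; rewrite foldl_cat -[foldl _ q0 _]e -foldl_cat.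
  exact: (H _).1.
rewrite cat_word_c => /LwrapE[_ + _]; rewrite count_gc count_gd addn0.
by move/esym.
Qed.

(* [false] generates [Lwrap] and [true] generates the words over [{a, b}]. *)
Definition Gwrap : cfg Gamma := @Cfg Gamma bool false
  [:: (false, [:: inr gc; inl false; inr gd]);
      (false, [:: inr ga; inl true]); (false, [:: inr gb; inl true]);
      (true, [:: inr ga; inl true]); (true, [:: inr gb; inl true]);
      (true, [::])].

(** The soundness invariant: every rule is an inclusion between these languages, so [form_lang] can
    only shrink along a derivation. *)
Definition symbol_lang (x : bool + Gamma) : set (seq Gamma) :=
  match x with
  | inl false => Lwrap
  | inl true => range (map emb)
  | inr y => [set [:: y]]
  end.

Definition form_lang (x : seq (bool + Gamma)) : set (seq Gamma) :=
  set_prod (map symbol_lang x).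

Lemma form_lang_cat x y :
  form_lang (x ++ y) = conc (form_lang x) (form_lang y).
Proof. by rewrite /form_lang map_cat set_prod_cat. Qed.

Lemma form_lang_inr w : form_lang (map inr w) = [set w].
Proof.
elim: w => // x w IHw; rewrite -cat1s map_cat form_lang_cat IHw.
apply/seteqP; split=> [_ [_ [_ -> [_ -> <-]] [_ -> <-]] //|_ ->].
by exists [:: x]; [exists [:: x] => //; exists [::] | exists w].
Qed.

Lemma sub_conc (T : Type) (A A' B B' : set (seq T)) :
  A `<=` A' -> B `<=` B' -> conc A B `<=` conc A' B'.
Proof.
move=> AC BD w [u Au [v Bv <-]].
by exists u; [exact: AC|exists v => //; exact: BD].
Qed.

Lemma rule_lang N y : (N, y) \in rules Gwrap ->
  form_lang y `<=` symbol_lang (inl N).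
Proof.
have Lx (x : ab) : conc [set [:: emb x]] (range (map emb)) `<=` Lwrap.
  move=> _ [_ -> [_ [u _ <-] <-]]; exists 0, (x :: u); split=> //.
  by rewrite wrapE word_u.
have Ax (x : ab) : conc [set [:: emb x]] (range (map emb)) `<=` range (map emb).
  by move=> _ [_ -> [_ [u _ <-] <-]]; exists (x :: u).
rewrite !inE /form_lang; do 5?case/orP; move=> /eqP[-> ->] /=; rewrite ?conc1.
- move=> _ [_ -> [_ [_ [n [u [u0 ->]]] [_ -> <-]] <-]]; exists n.+1, u;
    split=> //.
  by rewrite !wrapE -[[:: gc]]/(nseq 1 gc) -[[:: gd]]/(nseq 1 gd) cat_word
    addn1.
- exact: Lx la.
- exact: Lx lb.
- exact: Ax la.
- exact: Ax lb.
- by move=> _ ->; exists [::].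
Qed.

Lemma derives_lang x y : derives (G := Gwrap) x y ->
  form_lang y `<=` form_lang x.
Proof.
elim=> {x y} [x|x u N y v _ IH Ny]; first exact: subset_refl.
apply: subset_trans IH.
rewrite -(cat1s (inl N)) !form_lang_cat; apply: sub_conc => //.
apply: sub_conc => //; rewrite [X in _ `<=` X]/form_lang /= conc1.
exact: rule_lang.
Qed.

Lemma derives_wrap n u : u <> [::] ->
  derives (G := Gwrap) [:: inl false] (map inr (word n u n)).
Proof.
move=> u0.
have d1 : derives (G := Gwrap) [:: inl false]
    (nseq n (inr gc) ++ [:: inl false] ++ nseq n (inr gd)).
  elim: n => [|n IHn]; first exact: DerivesRefl.
  rewrite [nseq n.+1 (inr gc)]nseqSr.
  have := @DerivesStep _ Gwrap _ _ false [:: inr gc; inl false; inr gd] _ IHn.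
  by rewrite -!catA /=; apply.
have step N y l r x : derives (G := Gwrap) x (l ++ [:: inl N] ++ r) ->
    (N, y) \in rules Gwrap -> derives x (l ++ y ++ r).
  exact: DerivesStep.
have d2 : derives (G := Gwrap) [:: inl false]
    ((nseq n (inr gc) ++ map inr (map emb u)) ++ [:: inl true] ++ nseq n (inr
      gd)).
  elim/last_ind: u u0 => // u x IHu _.
  rewrite -cats1 !map_cat !catA -(catA _ _ [:: inl true]) -(catA _ _ (nseq _
    _)).
  (* The first letter replaces the start symbol [false]; every later one replaces [true]. *)
  have [u0|/eqP u0] := eqVneq u [::].
    by rewrite u0 cats0; apply: (step _ _ _ _ _ d1); case: x.
  by apply: (step _ _ _ _ _ (IHu u0)); case: x.
have := step _ [::] _ _ _ d2 isT.
by rewrite /word !map_cat !map_nseq !catA.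
Qed.

Lemma Lwrap_context_free : context_free Lwrap.
Proof.
exists Gwrap; apply/seteqP; split=> w.
  move=> /derives_lang/(_ w); rewrite form_lang_inr /form_lang /= conc1.
  exact.
by move=> [n [u [u0 ->]]]; exact: derives_wrap.
Qed.

(** The words c^n lie in distinct classes, since i - j is constant on a live class. *)
Lemma infinite_relclass : infinite_set (relclass Lwrap hwrap).
Proof.
move=> fR; apply: infinite_nat.
have : finite_set ((fun n =>
  cl Lwrap hwrap (nseq n gc)) @^-1` relclass Lwrap hwrap).
  apply: finite_preimage => // m n _ _ e.
  have : cl Lwrap hwrap (nseq m gc) (nseq n gc) by rewrite e; exact: theta_refl.
  have f : factor m [::] 0 by right.
  by rewrite -!word_c => /(theta_word _ _ _ f)[_]; rewrite !addn0.
by apply: sub_finite_set => n _; exists (nseq n gc).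
Qed.

Lemma Lwrap_not_FRP : ~ FRP Lwrap hwrap.
Proof.
move=> [_ fV]; have [p [s [Pp s1 nPs pp sp]]] := Pab_loop.
(* Every power of [p] with exponent at least 2 equals [s], hence the shift [n.+2]. *)
have prod_p n : (\prod_(q <- nseq n.+2 p) q)%g = s.
  elim: n => [|n IHn]; first by rewrite !big_cons big_nil mulg1.
  rewrite nseqSr big_cat IHn big_seq1; exact: sp.
have P36p n : {in nseq n p, forall q, P36 q}.
  by move=> q /nseqP[-> _]; apply/P36_Pab.
apply: infinite_nat.
have : finite_set ((fun n => (Wcl s, seqM 1 (nseq n.+2 p) 1)) @^-1`
    [set pr | relprime Lwrap hwrap pr.1 /\ Val Lwrap hwrap pr.1 pr.2]).
  apply: finite_preimage => // m n _ _ /(congr1 snd)/(congr1 size).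
  by rewrite [_.2 in LHS]/= [_.2 in RHS]/= !size_seqM /= !size_nseq; lia.
apply: sub_finite_set => n _; split=> /=; first exact: relprime_W.
rewrite Val_W //; right; exists ([:: Ccl] ++ map Mcl (nseq n.+2 p)); last first.
  by exists [:: Dcl].
exists [:: Ccl] => //; exists (map Mcl (nseq n.+2 p)) => //; apply/Icl_seq.
exists (nseq n.+2 p); split=> // l m r e m2 Pm; apply: nPs; apply/P36_Pab.
(* A block of length at least 2 is again such a power; its value is the nonprime [s]. *)
have em : m = nseq (size m) p.
  apply/all_pred1P/allP => q qm.
  have : q \in nseq n.+2 p by rewrite e !mem_cat qm orbT.
  by move=> /nseqP[->]; rewrite /= eqxx.
case: (size m) m2 em => [|[|k]] // _ em.
by rewrite em prod_p in Pm.
Qed.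

Theorem theorem13p4 :
  context_free Lwrap /\ ~ regular setT Lwrap /\
  unit_separated Lwrap hwrap /\
  substitutable Lwrap hwrap /\
  infinite_set (relclass Lwrap hwrap) /\
  finite_set (relprime Lwrap hwrap) /\
  (forall X, relclass Lwrap hwrap X -> live Lwrap X ->
     X <> unitcl Lwrap hwrap ->
     exists! s, exact_factorization Lwrap hwrap X s) /\
  FSRP Lwrap hwrap /\ ~ FRP Lwrap hwrap /\
  relprime Lwrap hwrap =
    [set Ccl; Dcl] `|` Mcl @` P36 `|` Wcl @` [set s | s <> 1%g] /\
  (forall s, s <> 1%g -> (P36 s <-> relprime Lab h36 (Mab s))) /\
  Val Lwrap hwrap Ccl = set0 /\
  Val Lwrap hwrap Dcl = set0 /\
  (forall p, P36 p ->
     Val Lwrap hwrap (Mcl p) = map embcl @` Val Lab h36 (Mab p)) /\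
  (forall s, s <> 1%g ->
     Val Lwrap hwrap (Wcl s) =
       [set [:: Ccl; Wcl s; Dcl]] `|`
       conc (conc [set [:: Ccl]] (Icl s)) [set [:: Dcl]]).
Proof.
split; first exact: Lwrap_context_free.
split; first exact: Lwrap_not_regular.
split; first exact: cl_nil.
split; first exact: substitutable_Lwrap.
split; first exact: infinite_relclass.
split; first exact: finite_relprime.
split; first exact: unique_factorization.
split; first exact: FSRP_Lwrap.
split; first exact: Lwrap_not_FRP.
split; first exact: relprime_Lwrap.
split.
  move=> s s1; rewrite P36_Pab relprime_Lab;
    split=> [Ps|[t Pt /(Mab_inj s1) ->] //].
  by exists s.
split; first exact/Val_letter/relprime_C.
split; first exact/Val_letter/relprime_D.
by split; [exact: Val_M_embcl|exact: Val_W].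
Qed.
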